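(* Let $E=\mathbb C/(\mathbb Z+\tau\mathbb Z)$, let $(K,\vec n)$ be an arbitrary Wen datum, $\vec\xi\in\mathbb C^g$, and $\vec u=K^{-1}\vec e$. Let $\iota:\mathsf W_{K,\vec\xi}\to\mathsf V_{K,\vec n,\vec\xi}$ be the isomorphism of vector spaces $\iota(\Phi)=\Phi(\vec w)\cdot D_{K,\vec n}$. Then $$T_1\circ\iota=\iota\circ S_{\vec u}\qquad\text{and}\qquad T_2\circ\iota=\iota\circ R_{\vec u}$$ as maps $\mathsf W_{K,\vec\xi}\to\mathsf V_{K,\vec n,\vec\xi}$. In particular, for the basis $(\Phi_{\vec c})_{\vec c\in\Pi}$ of $\mathsf V_{K,\vec n,\vec\xi}$ one has $$T_1(\Phi_{\vec c})=\upsilon(\vec u,\vec c)\,\Phi_{\vec c}\qquad\text{and}\qquad T_2(\Phi_{\vec c})=\Phi_{\vec c+\vec u}.$$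
   Context: Wen datum. $\mathbb N=\{1,2,\dots\}$, $\mathbb N_0=\mathbb N\cup\{0\}$. A Wen matrix is a symmetric positive definite $K\in\mathrm{Mat}_{g\times g}(\mathbb N_0)$ whose diagonal entries are either all even or all odd and such that all entries of $K^{-1}\vec e$ are positive, $\vec e=(1,\dots,1)^t$. A Wen datum is a pair $(K,\vec n)$ with $K$ a Wen matrix and $\vec n=(n_1,\dots,n_g)^t\in\mathbb N^g$ such that $K\vec n=d\vec e$ for some $d\in\mathbb N$. Put $\Omega=\tau K$, $\mathrm{Im}\,\tau>0$, $\Pi=K^{-1}\mathbb Z^g/\mathbb Z^g$, $\upsilon([\vec a],[\vec b])=\exp(2\pi i\,\vec a^tK\vec b)$ for $[\vec a],[\vec b]\in\Pi$. $\varphi(z)=\exp(-\pi i\tau-2\pi iz)$; for $k\in\mathbb Z$, $\xi\in\mathbb C$, $\mathcal L_{k,\xi}$ is the line bundle on $E$ whose sections are functions $f$ on $\mathbb C$ with $f(z+1)=f(z)$, $f(z+\tau)=\exp(-2\pi i\xi)\varphi(z)^kf(z)$; $\mathcal L^\sharp_{k,\xi}$: same rules with an additional factor $-1$ on the right-hand side of both. $X=E^{n_1}\times\dots\times E^{n_g}$ with coordinates $z^{(k)}_p$ ($1\le k\le g,1\le p\le n_k$); $\mathcal W_{K,\vec n,\vec\xi}$ is the external tensor product over all $(k,p)$ of $\mathcal L_{d,\xi_k}$ if $K_{11}+d$ is even, and of $\mathcal L^\sharp_{d,\xi_k}$ otherwise; $\mathsf W_{K,\vec n,\vec\xi}=\Gamma(X,\mathcal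 W_{K,\vec n,\vec\xi})$. With $\Xi_K=\sum_kK_{kk}\sum_{p<q}[z^{(k)}_p=z^{(k)}_q]+\sum_{k<l}K_{kl}\sum_{p,q}[z^{(k)}_p=z^{(l)}_q]$, $\mathsf V_{K,\vec n,\vec\xi}=\Gamma(X,\mathcal W_{K,\vec n,\vec\xi}(-[\Xi_K]))\subset\mathsf W_{K,\vec n,\vec\xi}$. $w_k=\sum_pz^{(k)}_p$, $\vec w=(w_1,\dots,w_g)^t$; $D_{K,\vec n}=\prod_k\prod_{p<q}\vartheta(z^{(k)}_p-z^{(k)}_q)^{K_{kk}}\prod_{k<l}\prod_{p,q}\vartheta(z^{(k)}_p-z^{(l)}_q)^{K_{kl}}$ with $\vartheta(z)=\sum_{k\in\mathbb Z}\exp(\pi i\tau(k+\frac12)^2+2\pi i(k+\frac12)(z+\frac12))$; $\Phi_{\vec c}=\Theta[\vec c,\vec 0](K\vec w+\vec\xi\,|\,\Omega)D_{K,\vec n}$, where $\Theta[\vec a,\vec b](\vec z|\Omega)=\sum_{\vec k\in\mathbb Z^g}\exp(\pi i(\vec k+\vec a)^t\Omega(\vec k+\vec a)+2\pi i(\vec k+\vec a)^t(\vec z+\vec b))$. Put $U_{\vec l}(\vec z,\vec\xi)=\exp(-\pi i\,\vec l^{\,t}(2\vec\xi+2K\vec z+\Omega\vec l))$. $\mathsf W_{K,\vec\xi}$ is the space of holomorphic $H:\mathbb C^g\to\mathbb C$ with $H(\vec z+\vec l)=H(\vec z)$, $H(\vec z+\tau\vec l)=U_{\vec l}(\vec z,\vec\xi)H(\vec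 z)$ for all $\vec l\in\mathbb Z^g$. $(S_{\vec a}\Phi)(\vec z)=\Phi(\vec z+\vec a)$ and $(R_{\vec b}\Phi)(\vec z)=U_{\vec b}(\vec z,\vec\xi)^{-1}\Phi(\vec z+\tau\vec b)$. Magnetic translations $T_1,T_2$ act on $\mathsf W_{K,\vec n,\vec\xi}$ (and preserve $\mathsf V_{K,\vec n,\vec\xi}$) as the tensor products over all variables $z=z^{(k)}_p$ of the one-variable operators $(T_1f)(z)=f(z+\frac1d)$, $(T_2f)(z)=\exp\bigl(\frac{2\pi i\xi_k+\pi i\tau}{d}\bigr)\exp(2\pi iz)f(z+\frac\tau d)$. *)

(* Defs.v *)
From HB Require Import structures.
From mathcomp Require Import all_boot all_order all_algebra.
From mathcomp Require Import archimedean generic_quotient ring_quotient.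
From mathcomp Require Import complex.
From mathcomp Require Import all_classical all_reals all_analysis.
From mathcomp.analysis Require Import showcase.summability.

Set Implicit Arguments.
Unset Strict Implicit.
Unset Printing Implicit Defensive.

Import Order.TTheory GRing.Theory Num.Theory.
Import numFieldNormedType.Exports.

Local Open Scope quotient_scope.
Local Open Scope classical_set_scope.
Local Open Scope ring_scope.

(* R[i], retyped as an abstract numFieldType so that it (and matrices over it)
   inherit the normed-module structure of MathComp-Analysis; `differentiable`
   is then complex (Frechet) differentiability. *)
Definition cplx (R : realType) : numFieldType := (R[i])%C.

Section ComplexAnalysis.
Variable R : realType.
Local Notation C := (cplx R).

Definition expC (z : C) : C :=
  Complex (expR (complex.Re z) * cos (complex.Im z))
          (expR (complex.Re z) * sin (complex.Im z)).

Definition piC : C := Complex pi 0.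
Definition iC : C := Complex 0 1.

Definition holomorphic m (f : 'cV[C]_m -> C) : Prop :=
  forall z, differentiable f z.

Definition natmx m1 m2 (A : 'M[nat]_(m1, m2)) : 'M[C]_(m1, m2) :=
  map_mx (fun k : nat => k%:R) A.
Definition intmx m1 m2 (A : 'M[int]_(m1, m2)) : 'M[C]_(m1, m2) :=
  map_mx intr A.
Definition ratmx m1 m2 (A : 'M[rat]_(m1, m2)) : 'M[C]_(m1, m2) :=
  map_mx ratr A.

Definition dot m (a b : 'cV[C]_m) : C := (a^T *m b) 0 0.

(* Infinite sums are unordered sums, i.e. limits over the finite subsets of
   the index set. *)
Definition Theta m (a b z : 'cV[C]_m) (Omega : 'M[C]_m) : C :=
  summability.sum (fun k : 'cV[int]_m =>
    let v := intmx k + a in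
    expC (piC * iC * dot v (Omega *m v) + 2 * piC * iC * dot v (z + b))).

Definition vartheta (tau z : C) : C :=
  summability.sum (fun k : int =>
    let v : C := k%:~R + 2^-1 in
    expC (piC * iC * tau * v ^+ 2 + 2 * piC * iC * v * (z + 2^-1))).

Definition lattice (tau : C) : set C :=
  [set x | exists a b : int, x = a%:~R + b%:~R * tau].

End ComplexAnalysis.

Section WenDatum.
Variable g : nat.

Definition ratK (K : 'M[nat]_g.+1) : 'M[rat]_g.+1 :=
  map_mx (fun k : nat => k%:R) K.

(* u = K^-1 e *)
Definition wen_u (K : 'M[nat]_g.+1) : 'cV[rat]_g.+1 :=
  invmx (ratK K) *m const_mx 1.

Definition posdef (R : realType) (K : 'M[nat]_g.+1) : Prop :=
  forall x : 'cV[R]_g.+1, x != 0 ->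
    0 < (x^T *m map_mx (fun k : nat => k%:R) K *m x) 0 0.

Definition wen_matrix (R : realType) (K : 'M[nat]_g.+1) : Prop :=
  [/\ K^T = K,
      posdef R K,
      (forall i, ~~ odd (K i i)) \/ (forall i, odd (K i i)) &
      forall i, 0 < wen_u K i 0].

(* The Wen datum (K, n), together with the integer d determined by it. *)
Definition wen_datum (R : realType) (K : 'M[nat]_g.+1) (n : 'cV[nat]_g.+1)
    (d : nat) : Prop :=
  [/\ wen_matrix R K, forall k, (0 < n k ord0)%N, (0 < d)%N &
      K *m n = const_mx d].

End WenDatum.

Section Characteristics.
Variable g : nat.

Definition int_vec : {pred 'cV[rat]_g.+1} :=
  [pred x : 'cV[rat]_g.+1 | [forall i, x i 0 \is a Num.int]].

Fact int_vec_zmod_closed : zmod_closed int_vec.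
Proof.
split=> [|x y /forallP xi /forallP yi]; apply/forallP => i; rewrite !mxE.
  exact: rpred0.
by apply: rpredB; [exact: xi | exact: yi].
Qed.
HB.instance Definition _ :=
  GRing.isZmodClosed.Build 'cV[rat]_g.+1 int_vec int_vec_zmod_closed.

(* The abelian group Q^g / Z^g, and the class [x] of a rational vector x. *)
Definition QmodZ : zmodType := Quotient.quot int_vec.
Definition vclass (x : 'cV[rat]_g.+1) : QmodZ := \pi_(Quotient.quot int_vec) x.
Definition vrepr (c : QmodZ) : 'cV[rat]_g.+1 :=
  repr (c : Quotient.quot int_vec).

(* K^-1 Z^g / Z^g, as a subset of Q^g / Z^g *)
Definition Pi (K : 'M[nat]_g.+1) : set QmodZ :=
  [set vclass (invmx (ratK K) *m l) | l in [set l | l \in int_vec]].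

End Characteristics.

Section Bundles.
Variables (R : realType) (g : nat).
Local Notation C := (cplx R).
Implicit Types (K : 'M[nat]_g.+1) (n : 'cV[nat]_g.+1) (d : nat).
Implicit Types (xi : 'cV[C]_g.+1) (tau : C).

(* Index set of the pairs (k, p) with p < n_k; a point of the universal cover
   C^(n_1 + ... + n_g) of X is a column vector indexed by its enumeration. *)
Definition cidx n : finType := {k : 'I_g.+1 & 'I_(n k ord0)}.
Local Notation pt n := 'cV[C]_#|cidx n|.

Definition ix n (k : 'I_g.+1) (p : 'I_(n k ord0)) : cidx n :=
  Tagged (fun k => 'I_(n k ord0)) p.

Definition coord n (z : pt n) (i : cidx n) : C :=
  z (enum_rank i) 0.

Definition shift1 n (i : cidx n) (t : C) : pt n :=
  t *: delta_mx (enum_rank i) 0.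

Definition wvec n (z : pt n) : 'cV[C]_g.+1 :=
  \col_k \sum_(p < n k ord0) coord z (ix p).

Definition phi tau (z : C) : C :=
  expC (- (piC R * iC R * tau) - 2 * piC R * iC R * z).

Definition bundle_sign K d : C :=
  if odd (K ord0 ord0 + d) then -1 else 1.

(* The space W_{K, n, xi} of sections over X *)
Definition W_X tau K n d xi : set (pt n -> C) :=
  [set f | holomorphic f /\
    forall (i : cidx n) (z : pt n),
      f (z + shift1 i 1) = bundle_sign K d * f z /\
      f (z + shift1 i tau) =
        bundle_sign K d * expC (- (2 * piC R * iC R * xi (tag i) 0))
          * phi tau (coord z i) ^+ d * f z].

(* Product of F over the pairs of variables that make up Xi_K, with the
   multiplicities of Xi_K. *)
Definition pair_prod K n (F : cidx n -> cidx n -> C) : C :=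
  (\prod_(k < g.+1) \prod_(p < n k ord0) \prod_(q < n k ord0 | (p < q)%N)
      F (ix p) (ix q) ^+ K k k) *
  (\prod_(k < g.+1) \prod_(l < g.+1 | (k < l)%N) \prod_(p < n k ord0) \prod_(q < n l ord0)
      F (ix p) (ix q) ^+ K k l).

Definition D tau K n (z : pt n) : C :=
  pair_prod K (fun i j => vartheta tau (coord z i - coord z j)).

(* Near x0, the divisor [z_i = z_j] on X = E^N pulls back to the zero locus of
   z_i - z_j - lambda if lambda := x0_i - x0_j lies in Z + tau Z, and is empty
   otherwise. *)
Definition diag_eqn tau n (x0 z : pt n) (i j : cidx n) : C :=
  let lambda := coord x0 i - coord x0 j in
  if `[< lattice tau lambda >] then coord z i - coord z j - lambda else 1.

(* The space V_{K, n, xi}: sections divisible, locally around every point, by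
   a local equation of Xi_K. *)
Definition V_X tau K n d xi : set (pt n -> C) :=
  [set f | W_X tau K d xi f /\
    forall x0 : pt n, exists h : pt n -> C,
      \forall z \near x0, differentiable h z /\
        f z = h z * pair_prod K (diag_eqn tau x0 z)].

Definition Omega tau K : 'M[C]_g.+1 := tau *: natmx R K.

Definition U tau K (l z xi : 'cV[C]_g.+1) : C :=
  expC (- (piC R * iC R *
    dot l (2 *: xi + 2 *: (natmx R K *m z) + Omega tau K *m l))).

(* The space W_{K, xi} *)
Definition W_cm tau K xi : set ('cV[C]_g.+1 -> C) :=
  [set H | holomorphic H /\
    forall (l : 'cV[int]_g.+1) (z : 'cV[C]_g.+1),
      H (z + intmx R l) = H z /\
      H (z + tau *: intmx R l) = U tau K (intmx R l) z xi * H z].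

Definition S_op (a : 'cV[C]_g.+1) (H : 'cV[C]_g.+1 -> C) : 'cV[C]_g.+1 -> C :=
  fun z => H (z + a).

Definition R_op tau K xi (b : 'cV[C]_g.+1) (H : 'cV[C]_g.+1 -> C) :
    'cV[C]_g.+1 -> C :=
  fun z => (U tau K b z xi)^-1 * H (z + tau *: b).

Definition iota_WV tau K n (H : 'cV[C]_g.+1 -> C) : pt n -> C :=
  fun z => H (wvec z) * D tau K z.

(* The tensor products over all variables of the one-variable operators
   f |-> f(z + 1/d) and
   f |-> exp((2 pi i xi_k + pi i tau)/d) exp(2 pi i z) f(z + tau/d). *)
Definition T1 n d (f : pt n -> C) : pt n -> C :=
  fun z => f (z + const_mx (d%:R^-1)).

Definition T2 tau n d xi (f : pt n -> C) : pt n -> C :=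
  fun z =>
    (\prod_(i : cidx n)
       (expC ((2 * piC R * iC R * xi (tag i) 0 + piC R * iC R * tau) / d%:R)
        * expC (2 * piC R * iC R * coord z i)))
    * f (z + const_mx (tau / d%:R)).

(* Phi_c and upsilon are defined through representatives of classes; on Pi K
   the values do not depend on the choice of representatives. *)
Definition Phi tau K n xi (c : QmodZ g) : pt n -> C :=
  fun z => Theta (ratmx R (vrepr c)) 0 (natmx R K *m wvec z + xi) (Omega tau K)
           * D tau K z.

Definition upsilon K (a b : QmodZ g) : C :=
  expC (2 * piC R * iC R *
    dot (ratmx R (vrepr a)) (natmx R K *m ratmx R (vrepr b))).

End Bundles.

Arguments W_X {R g}.
Arguments V_X {R g}.
Arguments iota_WV {R g}.
Arguments T1 {R g}.
Arguments T2 {R g}.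
Arguments Phi {R g}.
Arguments upsilon R {g}.

(* Main.v *)
(* Both intertwining relations are computations with quasi-periods: every
   magnetic translation moves all variables by the same amount, so it leaves D
   unchanged and translates the vector w by n/d = K^-1 e = u, respectively by
   tau u; the prefactor of T_2 is U_u(w)^-1 because K u = e.  The effect on
   Phi_c comes from Theta[c](y + e) = exp(2 pi i c.e) Theta[c](y) and from the
   identity Theta[c](y + Omega u) = U_u Theta[c + u](y).

   That iota lands in V uses theta(z + 1) = - theta(z), theta(z + tau) =
   - phi(z) theta(z) and the fact that theta is divisible by z - lambda, with
   entire quotient, for every lattice point lambda; the latter reduces to
   lambda = 0, where it holds because theta is odd.

   Holomorphy of theta and Theta: both are sums of c_k exp(l_k(z)) with l_k
   linear, and the second-order Taylor remainder of each term is summable as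
   soon as the sum of |c_k| exp(r |l_k|) is finite for all r.  This is a Gaussian
   sum, which is compared with a product of geometric series. *)

From HB Require Import structures.
Require Import Defs.
From mathcomp Require Import all_boot all_order all_algebra.
From mathcomp Require Import finmap complex.
From mathcomp Require Import ring lra zify.
From mathcomp Require Import all_classical all_reals all_analysis.
From mathcomp.analysis Require Import showcase.summability.

Set Implicit Arguments.
Unset Strict Implicit.
Unset Printing Implicit Defensive.

Import Order.TTheory GRing.Theory Num.Theory.
Import numFieldNormedType.Exports.

Local Open Scope classical_set_scope.
Local Open Scope ring_scope.

Local Notation sum := summability.sum.
Local Notation coord := Defs.coord.

(** * The complex exponential *)

Section ComplexNumbers.
Variable R : realType.
Local Notation C := (cplx R).
Implicit Types (x y : R) (z w : C).

(** The equation K n = d e governs the bookkeeping for [iota_WV]. When only z_i moves by tau, D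
    acquires the factors (- phi(z_i - z_j))^K_kl over all j other than i, with k and l the blocks of
    z_i and z_j. Over all variables the exponents K_kl add up to d, so these factors and the
    multiplier of H(w) combine to phi(z_i)^d, while the sign (-1)^(d - K_kk) is what separates the
    two bundles L and L^sharp.

    On the analytic side, theta(t) / t is extended over 0 by the derivative, and its
    differentiability there is read off the second-order expansion of the series. This calls for the
    exponential with a cubic remainder, although a quadratic one suffices for holomorphy. Powers of
    the frequencies created by such expansions are absorbed into exponentials, which is why
    summability is asked for every rate r.

    Everything on Q^g / Z^g goes through chosen representatives; comparing two of them costs an
    integral vector, absorbed by reindexing Theta or by the integrality of K c for c in Pi. *)

Definition rc : R -> C := real_complex R.
Lemma rc_zmod : zmod_morphism rc. Proof. exact: (raddfB (real_complex R)). Qed.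
Lemma rc_monoid : monoid_morphism rc.
Proof. by split; [exact: (rmorph1 (real_complex R)) | exact: (rmorphM (real_complex R))]. Qed.
HB.instance Definition _ := GRing.isZmodMorphism.Build R C rc rc_zmod.
HB.instance Definition _ := GRing.isMonoidMorphism.Build R C rc rc_monoid.

(* The library's norm on cplx R takes values in cplx R; cn is the same modulus
   with values in R, where lra and nra apply. *)
Definition cn (z : C) : R := @ComplexField.Normc.normc R z.

Lemma cnE z : `|z| = rc (cn z). Proof. by []. Qed.
Lemma rc_le x y : (rc x <= rc y) = (x <= y). Proof. exact: lecR. Qed.
Lemma rc_lt x y : (rc x < rc y) = (x < y). Proof. exact: ltcR. Qed.
Lemma cn_ge0 z : 0 <= cn z.
Proof. by rewrite -rc_le rmorph0 -cnE. Qed.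
Lemma cnM z w : cn (z * w) = cn z * cn w. Proof. exact: ComplexField.Normc.normcM. Qed.
Lemma cnD z w : cn (z + w) <= cn z + cn w. Proof. exact: le_normcD. Qed.
Lemma cn_rc x : cn (rc x) = `|x|.
Proof. by rewrite /cn /= expr0n addr0 sqrtr_sqr. Qed.
Lemma cn0 : cn 0 = 0. Proof. exact: ComplexField.Normc.normc0. Qed.
Lemma cn_sum (I : Type) (r : seq I) (F : I -> C) :
  cn (\sum_(i <- r) F i) <= \sum_(i <- r) cn (F i).
Proof.
elim/big_ind2 : _ => //[|a b c d ab cd]; first by rewrite cn0.
by apply: (le_trans (cnD _ _)); exact: lerD.
Qed.
Lemma ReIm_decomp z : z = rc (complex.Re z) + iC R * rc (complex.Im z).
Proof. exact: complexE. Qed.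
Lemma cn_iC : cn (iC R) = 1.
Proof. by rewrite /cn /= expr0n add0r expr1n sqrtr1. Qed.
Lemma cn_le z : cn z <= `|complex.Re z| + `|complex.Im z|.
Proof.
by rewrite {1}(ReIm_decomp z); apply: (le_trans (cnD _ _)); rewrite cnM cn_iC mul1r !cn_rc.
Qed.
Lemma Re_le z : `|complex.Re z| <= cn z.
Proof. by rewrite -rc_le -cnE; exact: normc_ge_Re. Qed.
Lemma Im_le z : `|complex.Im z| <= cn z.
Proof.
rewrite -(mul1r (cn z)) -cn_iC -cnM; apply: le_trans (Re_le _).
by case: z => a b /=; rewrite mul0r mul1r sub0r normrN.
Qed.
Lemma piCE : piC R = rc pi. Proof. by []. Qed.

Lemma expCD z w : expC (z + w) = expC z * expC w.
Proof.
case: z w => a b [c d]; rewrite /expC /=.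
by apply/eqP; rewrite eq_complex /= expRD cosD sinD; apply/andP; split; apply/eqP; ring.
Qed.
Lemma expC0 : expC (0 : C) = 1.
Proof. by rewrite /expC /= expR0 cos0 sin0 mulr1 mulr0. Qed.
Lemma cn_expC z : cn (expC z) = expR (complex.Re z).
Proof.
rewrite /cn /expC /= !exprMn -mulrDr (cos2Dsin2) mulr1 sqrtr_sqr ger0_norm //.
Qed.
Lemma expC_neq0 z : expC z != 0.
Proof.
apply/eqP => /(congr1 cn); rewrite cn_expC cn0 => /eqP.
by rewrite gt_eqF // expR_gt0.
Qed.
Lemma expCN z : expC (- z) = (expC z)^-1.
Proof.
apply: (mulfI (expC_neq0 z)); rewrite -expCD subrr expC0 mulfV //.
exact: expC_neq0.
Qed.
Lemma expCMn z n : expC (z *+ n) = expC z ^+ n.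
Proof. by elim: n => [|n IH]; rewrite ?mulr0n ?expC0 // mulrS exprS expCD IH. Qed.
Lemma expC_sum (I : Type) (r : seq I) (P : pred I) (F : I -> C) :
  expC (\sum_(i <- r | P i) F i) = \prod_(i <- r | P i) expC (F i).
Proof. exact: (big_morph _ expCD expC0). Qed.
Lemma expC_pi : expC (piC R * iC R) = -1.
Proof.
rewrite /expC /piC /iC /= !(mulr0, mul0r, mulr1, mul1r, subr0, addr0) expR0.
by rewrite cospi sinpi !mul1r; apply/eqP; rewrite eq_complex /= oppr0 !eqxx.
Qed.
Lemma expC_2pi : expC (2 * piC R * iC R) = 1.
Proof.
rewrite -mulrA (_ : 2 * _ = piC R * iC R + piC R * iC R); last by rewrite mulr2n mulrDl mul1r.
by rewrite expCD expC_pi mulrNN mulr1.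
Qed.
Lemma expC_2pi_nat n : expC (2 * piC R * iC R * n%:R) = 1.
Proof. by rewrite mulr_natr expCMn expC_2pi expr1n. Qed.
Lemma expC_2pi_int (k : int) : expC (2 * piC R * iC R * k%:~R) = 1.
Proof.
case: k => n; first exact: expC_2pi_nat.
by rewrite NegzE mulrNz mulrN expCN expC_2pi_nat invr1.
Qed.

(** * Taylor estimates with explicit remainders *)

(** Mean value theorem on the segment from 0 to x. Since [M] may depend on x, the estimate of one
    Taylor remainder can serve as the bound on the derivative of the next one. Every estimate below
    arises this way, with the factors 1/n! given away. *)
Lemma deriv_bound (f df : R -> R) (M x : R) :
  (forall t : R, is_derive t (1 : R) f (df t)) -> f 0 = 0 ->
  (forall t, `|t| <= `|x| -> `|df t| <= M) -> `|f x| <= M * `|x|.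
Proof.
move=> fd f0 dfM.
have fc : continuous f.
  by move=> t; apply/differentiable_continuous/derivable1_diffP; case: (fd t).
case: (leP 0 x) => x0.
  have [|c cx] := MVT_segment x0 (fun t _ => fd t).
    exact: continuous_subspaceT.
  rewrite f0 !subr0 => ->; rewrite normrM ler_wpM2r //; apply: dfM.
  by move: cx; rewrite in_itv /= => /andP[c0 cx]; rewrite !ger0_norm.
have [|c cx] := MVT_segment (ltW x0) (fun t _ => fd t).
  exact: continuous_subspaceT.
rewrite f0 !sub0r => /eqP; rewrite eqr_oppLR => /eqP ->.
rewrite -mulrN opprK normrM ler_wpM2r //; apply: dfM.
by move: cx; rewrite in_itv /= => /andP[c0 cx]; rewrite !ler0_norm ?lerN2 // ltW.
Qed.

Lemma expR_le_abs t x : `|t| <= `|x| -> expR t <= expR `|x|.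
Proof. by move=> tx; rewrite ler_expR; apply: le_trans tx; exact: ler_norm. Qed.

Lemma expR_taylor1 x : `|expR x - 1| <= expR `|x| * `|x|.
Proof.
apply: (@deriv_bound (fun t => expR t - 1) expR) => [t||t tx].
- by apply: is_derive_eq; rewrite subr0.
- by rewrite expR0 subrr.
- by rewrite ger0_norm ?expR_ge0 // expR_le_abs.
Qed.
Lemma expR_taylor2 x : `|expR x - 1 - x| <= expR `|x| * `|x| ^+ 2.
Proof.
rewrite expr2 mulrA.
apply: (@deriv_bound (fun t => expR t - 1 - t) (fun t => expR t - 1)) => [t||t tx].
- by apply: is_derive_eq; rewrite subr0.
- by rewrite expR0 subrr subr0.
- apply: (le_trans (expR_taylor1 t)); apply: ler_pM => //.
  by rewrite ler_expR.
Qed.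
Lemma expR_taylor3 x : `|expR x - 1 - x - x ^+ 2 / 2| <= expR `|x| * `|x| ^+ 3.
Proof.
rewrite [in leRHS]exprSr mulrA.
apply: (@deriv_bound (fun t => expR t - 1 - t - t ^+ 2 / 2) (fun t => expR t - 1 - t)) => [t||t tx].
- apply: is_derive_eq; rewrite subr0 /GRing.scale /= .
  by field.
- by rewrite expR0 subrr subr0 expr0n mul0r subr0.
- apply: (le_trans (expR_taylor2 t)); apply: ler_pM => //.
  by rewrite ler_expR.
  by rewrite lerXn2r ?nnegrE.
Qed.
Lemma sin_taylor1 x : `|sin x| <= `|x|.
Proof.
rewrite -[leRHS]mul1r.
apply: (@deriv_bound (@sin R) (@cos R)) => [|t tx]; first exact: sin0.
by rewrite ler_norml cos_geN1 cos_le1.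
Qed.
Lemma cos_taylor1 x : `|cos x - 1| <= `|x|.
Proof.
rewrite -[leRHS]mul1r.
apply: (@deriv_bound (fun t => cos t - 1) (fun t => - sin t)) => [t||t tx].
- by apply: is_derive_eq; rewrite subr0.
- by rewrite cos0 subrr.
- by rewrite normrN ler_norml sin_geN1 sin_le1.
Qed.
Lemma cos_taylor2 x : `|cos x - 1| <= `|x| ^+ 2.
Proof.
rewrite expr2.
apply: (@deriv_bound (fun t => cos t - 1) (fun t => - sin t)) => [t||t tx].
- by apply: is_derive_eq; rewrite subr0.
- by rewrite cos0 subrr.
- by rewrite normrN; apply: le_trans (sin_taylor1 t) tx.
Qed.
Lemma sin_taylor2 x : `|sin x - x| <= `|x| ^+ 2.
Proof.
rewrite expr2.
apply: (@deriv_bound (fun t : R => sin t - t) (fun t => cos t - 1)) => [|t tx].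
- by rewrite sin0 subrr.
- by apply: le_trans (cos_taylor1 t) tx.
Qed.
Lemma sin_taylor3 x : `|sin x - x| <= `|x| ^+ 3.
Proof.
rewrite [in leRHS]exprSr.
apply: (@deriv_bound (fun t : R => sin t - t) (fun t => cos t - 1)) => [|t tx].
- by rewrite sin0 subrr.
- by apply: (le_trans (cos_taylor2 t)); rewrite lerXn2r ?nnegrE.
Qed.
Lemma cos_taylor3 x : `|cos x - 1 + x ^+ 2 / 2| <= `|x| ^+ 3.
Proof.
rewrite [in leRHS]exprSr.
apply: (@deriv_bound (fun t => cos t - 1 + t ^+ 2 / 2) (fun t => - (sin t - t))) => [t||t tx].
- apply: is_derive_eq; rewrite subr0 /GRing.scale /=; by field.
- by rewrite cos0 subrr expr0n mul0r addr0.
- by rewrite normrN; apply: (le_trans (sin_taylor2 t)); rewrite lerXn2r ?nnegrE.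
Qed.

(** The constant 4 counts real pieces: with z = x + iy, the real and the imaginary part of the
    remainder each split into two terms, and each term is at most [B] by the one-variable
    estimates. *)
Lemma expC_taylor2 z : cn (expC z - 1 - z) <= 4 * (expR (cn z) * cn z ^+ 2).
Proof.
have := Re_le z; have := Im_le z; have := cn_ge0 z.
move: (cn z) => r r0 yr xr; set B := expR r * r ^+ 2.
case: z yr xr => x y yr xr; rewrite /= in xr yr.
have ex : `|expR x| <= expR r.
  by rewrite ger0_norm ?expR_ge0 // ler_expR; apply: le_trans xr; exact: ler_norm.
have exr : expR `|x| <= expR r by rewrite ler_expR.
have rr : `|r| = r by rewrite ger0_norm.
have b1 : `|expR x * (cos y - 1)| <= B.
  rewrite normrM ler_pM // (le_trans (cos_taylor2 y)) //.
  by rewrite lerXn2r ?nnegrE.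
have b2 : `|expR x - 1 - x| <= B.
  by rewrite (le_trans (expR_taylor2 x)) // ler_pM ?expR_ge0 ?exprn_ge0 ?lerXn2r ?nnegrE.
have b3 : `|expR x * (sin y - y)| <= B.
  rewrite normrM ler_pM // (le_trans (sin_taylor2 y)) //.
  by rewrite lerXn2r ?nnegrE.
have b4 : `|(expR x - 1) * y| <= B.
  rewrite normrM /B expr2 mulrA ler_pM // (le_trans (expR_taylor1 x)) //.
  by rewrite ler_pM ?expR_ge0.
apply: (le_trans (cn_le _)); rewrite /expC /= subr0.
have -> : expR x * cos y - 1 - x = expR x * (cos y - 1) + (expR x - 1 - x) by ring.
have -> : expR x * sin y - y = expR x * (sin y - y) + (expR x - 1) * y by ring.
have := ler_normD (expR x * (cos y - 1)) (expR x - 1 - x).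
have := ler_normD (expR x * (sin y - y)) ((expR x - 1) * y).
by lra.
Qed.

(** Five pieces bounded by [B]. Beyond those of the quadratic case there is
    [(expR x - 1) * (y ^+ 2 / 2)], because the remainder of the cosine comes multiplied by exp(x)
    while z^2 / 2 contains y^2 / 2 without that factor. *)
Lemma expC_taylor3 z :
  cn (expC z - 1 - z - z ^+ 2 / 2) <= 5 * (expR (cn z) * cn z ^+ 3).
Proof.
have := Re_le z; have := Im_le z; have := cn_ge0 z.
move: (cn z) => r r0 yr xr; set B := expR r * r ^+ 3.
case: z yr xr => x y yr xr; rewrite /= in xr yr.
have ex : `|expR x| <= expR r.
  by rewrite ger0_norm ?expR_ge0 // ler_expR; apply: le_trans xr; exact: ler_norm.
have exr : expR `|x| <= expR r by rewrite ler_expR.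
have rr : `|r| = r by rewrite ger0_norm.
have b1 : `|expR x * (cos y - 1 + y ^+ 2 / 2)| <= B.
  rewrite normrM ler_pM // (le_trans (cos_taylor3 y)) //.
  by rewrite lerXn2r ?nnegrE.
have b2 : `|expR x - 1 - x - x ^+ 2 / 2| <= B.
  by rewrite (le_trans (expR_taylor3 x)) // ler_pM ?expR_ge0 ?exprn_ge0 ?lerXn2r ?nnegrE.
have b3 : `|expR x * (sin y - y)| <= B.
  rewrite normrM ler_pM // (le_trans (sin_taylor3 y)) //.
  by rewrite lerXn2r ?nnegrE.
have b4 : `|(expR x - 1 - x) * y| <= B.
  rewrite normrM /B exprSr mulrA ler_pM // (le_trans (expR_taylor2 x)) //.
  by rewrite ler_pM ?expR_ge0 ?exprn_ge0 ?lerXn2r ?nnegrE.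
have b5 : `|(expR x - 1) * (y ^+ 2 / 2)| <= B.
  rewrite normrM /B [in leRHS]exprS mulrA ler_pM // ?(le_trans (expR_taylor1 x)) //.
    by rewrite ler_pM ?expR_ge0.
  rewrite ger0_norm ?divr_ge0 ?sqr_ge0 //.
  have : `|y| ^+ 2 <= r ^+ 2 by rewrite lerXn2r ?nnegrE.
  by rewrite -normrX ger0_norm ?sqr_ge0 //; have := sqr_ge0 y; lra.
have -> : expC (Complex x y : C) - 1 - Complex x y - (Complex x y : C) ^+ 2 / 2 =
  Complex (expR x * (cos y - 1 + y ^+ 2 / 2) - (expR x - 1) * (y ^+ 2 / 2)
              + (expR x - 1 - x - x ^+ 2 / 2))
          (expR x * (sin y - y) + (expR x - 1 - x) * y).
  have -> : (Complex x y : C) ^+ 2 / 2 = Complex ((x ^+ 2 - y ^+ 2) / 2) (x * y).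
    apply: (mulIf (_ : (2 : C) != 0)); first by rewrite pnatr_eq0.
    rewrite mulfVK ?pnatr_eq0 //.
    by apply/eqP; rewrite eq_complex /=; apply/andP; split; apply/eqP; field.
  by apply/eqP; rewrite eq_complex /=; apply/andP; split; apply/eqP; field.
apply: (le_trans (cn_le _)) => /=.
have := ler_normD (expR x * (cos y - 1 + y ^+ 2 / 2) - (expR x - 1) * (y ^+ 2 / 2))
                  (expR x - 1 - x - x ^+ 2 / 2).
have := ler_normB (expR x * (cos y - 1 + y ^+ 2 / 2)) ((expR x - 1) * (y ^+ 2 / 2)).
have := ler_normD (expR x * (sin y - y)) ((expR x - 1 - x) * y).
by lra.
Qed.
End ComplexNumbers.
Arguments cn : simpl never.

(** * Unordered sums *)

#[local] Existing Instance totally_filter.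
Section UnorderedSums.
Variables (R : realType) (I : choiceType).
Local Notation C := (cplx R).
Implicit Types (f g : I -> C) (M : R) (A B : {fset I}).

Lemma partial_sumE (V : zmodType) (f : I -> V) A :
  partial_sum f A = \sum_(i <- A) f i.
Proof. by rewrite /partial_sum big_seq_fsetE. Qed.

Lemma fset_sum_le (f : I -> R) A B : (forall i, 0 <= f i) -> (A `<=` B)%fset ->
  \sum_(i <- A) f i <= \sum_(i <- B) f i.
Proof.
move=> f0 AB; rewrite [leRHS](big_fsetID _ (mem A)) /=.
rewrite (_ : [fset x in B | x \in A]%fset = A).
  by rewrite lerDl sumr_ge0.
apply/fsetP => x; rewrite !inE /= andbC.
by case: (boolP (x \in A)) => //= /(fsubsetP AB).
Qed.

(** Absolute summability as one bound for all finite partial sums of moduli. The explicit [M] is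
    what later bounds the sum itself. *)
Definition abs_bounded f M := forall A, \sum_(i <- A) cn (f i) <= M.

(** The partial sums form an increasing net and converge to their supremum. *)
Lemma nonneg_cvg (f : I -> R) M : (forall i, 0 <= f i) ->
  (forall A, \sum_(i <- A) f i <= M) ->
  exists l : R, partial_sum f @ totally --> l.
Proof.
move=> f0 fM; pose E := range (partial_sum f).
have supE : has_sup E.
  split; first by exists (partial_sum f fset0), fset0.
  by exists M => _ [A _ <-]; rewrite partial_sumE.
exists (sup E); apply/cvgrPdist_le => e e0.
have [_ [A _ <-] lA] := sup_adherent e0 supE.
exists A => // B /= AB.
have Bs : partial_sum f B <= sup E by apply: sup_upper_bound => //; exists B.
rewrite ger0_norm ?subr_ge0 //.
have : partial_sum f A <= partial_sum f B by rewrite !partial_sumE fset_sum_le.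
by lra.
Qed.

Lemma cvg_rc (f : I -> R) (l : R) : partial_sum f @ totally --> l ->
  partial_sum (fun i => rc (f i)) @ totally --> (rc l : C).
Proof.
move=> /cvgrPdist_le fl; apply/cvgrPdist_le => e e0.
(* A positive element of [C] has imaginary part 0, so [e] is the image of a real number. *)
have [eE e0'] : e = rc (complex.Re e) /\ 0 < complex.Re e.
  by case: e e0 => a b; rewrite ltcE /= => /andP[/eqP -> ->].
have [A _ AP] := fl _ e0'; exists A => // B /= AB.
rewrite eE !partial_sumE -rmorph_sum -rmorphB cnE cn_rc rc_le -partial_sumE.
exact: AP.
Qed.

Lemma sum_eq f (l : C) : partial_sum f @ totally --> l -> sum f = l.
Proof. by move=> fl; apply: cvg_lim. Qed.

Lemma partial_sumD (f g : I -> C) :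
  partial_sum (fun i => f i + g i) = partial_sum f \+ partial_sum g.
Proof. by apply/funext => A /=; rewrite !partial_sumE big_split. Qed.

Lemma partial_sumZ (a : C) (f : I -> C) :
  partial_sum (fun i => a * f i) = (fun A => a * partial_sum f A).
Proof. by apply/funext => A /=; rewrite !partial_sumE mulr_sumr. Qed.

Lemma partial_cvgD (f g : I -> C) (a b : C) :
  partial_sum f @ totally --> a -> partial_sum g @ totally --> b ->
  partial_sum (fun i => f i + g i) @ totally --> a + b.
Proof. by move=> fa gb; rewrite partial_sumD; exact: (cvgD fa gb). Qed.

Lemma partial_cvgZ (f : I -> C) (a c : C) : partial_sum f @ totally --> a ->
  partial_sum (fun i => c * f i) @ totally --> c * a.
Proof.
move=> fa; rewrite partial_sumZ.
exact: (@cvgMl_tmp _ _ totally _ (partial_sum f) c a).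
Qed.

(** Adding |f_i| to the real and to the imaginary part makes both families non-negative, with
    partial sums at most 2M. The monotone case applies to them and to |f_i|, and f is recovered as a
    linear combination. *)
Lemma abs_cvg f M : abs_bounded f M -> partial_sum f @ totally --> sum f.
Proof.
move=> fM.
pose a i := complex.Re (f i) + cn (f i).
pose b i := complex.Im (f i) + cn (f i).
pose c i := cn (f i).
have [i||la ha] := @nonneg_cvg a (M + M).
- rewrite /a; have := Re_le (f i); rewrite ler_norml => /andP[]; lra.
- move=> A; rewrite big_split lerD //=; apply: le_trans (fM A).
  by apply: ler_sum => i _; apply: le_trans (Re_le _); exact: ler_norm.
have [i||lb hb] := @nonneg_cvg b (M + M).
- rewrite /b; have := Im_le (f i); rewrite ler_norml => /andP[]; lra.
- move=> A; rewrite big_split lerD //=; apply: le_trans (fM A).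
  by apply: ler_sum => i _; apply: le_trans (Im_le _); exact: ler_norm.
have [i||lc hc] := @nonneg_cvg c M; [exact: cn_ge0 | exact: fM |].
move: ha hb hc => /cvg_rc ha /cvg_rc hb /cvg_rc hc.
suff H : partial_sum f @ totally -->
    ((rc la + -1 * rc lc) + iC R * (rc lb + -1 * rc lc) : C) by rewrite (sum_eq H).
have -> : f = fun i => (rc (a i) + -1 * rc (c i)) + iC R * (rc (b i) + -1 * rc (c i)).
  apply/funext => i; rewrite {1}(ReIm_decomp (f i)) /a /b !rmorphD /=; ring.
have hN (h : I -> R) (lh : R) (hl : partial_sum (fun i => rc (h i)) @ totally --> (rc lh : C)) :=
  partial_cvgD hl (partial_cvgZ (c := -1) hc).
exact: (partial_cvgD (hN _ _ ha) (partial_cvgZ (c := iC R) (hN _ _ hb))).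
Qed.

Lemma sumD f g M N : abs_bounded f M -> abs_bounded g N ->
  sum (fun i => f i + g i) = sum f + sum g.
Proof.
by move=> fM gN; apply: sum_eq; apply: partial_cvgD; [exact: abs_cvg fM | exact: abs_cvg gN].
Qed.

Lemma sumZ f (c : C) M : abs_bounded f M -> sum (fun i => c * f i) = c * sum f.
Proof. by move=> fM; apply: sum_eq; apply: partial_cvgZ; exact: abs_cvg fM. Qed.

Lemma sum_cn_le f M : abs_bounded f M -> cn (sum f) <= M.
Proof.
move=> fM; apply/ler_addgt0Pr => e e0.
have /cvgrPdist_le /(_ (rc e)) := abs_cvg fM.
rewrite -(rmorph0 (@rc R)) rc_lt => /(_ e0) [A _ /(_ A (fsubset_refl A))] /=.
rewrite cnE rc_le partial_sumE => H.
rewrite -(subrK (\sum_(i <- A) f i) (sum f)).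
apply: (le_trans (cnD _ _)); rewrite addrC lerD //.
by apply: (le_trans (cn_sum _ _)); exact: fM.
Qed.

Lemma abs_bounded_le f g M : (forall i, cn (f i) <= cn (g i)) ->
  abs_bounded g M -> abs_bounded f M.
Proof. by move=> fg gM A; apply: le_trans (gM A); exact: ler_sum. Qed.

Lemma abs_boundedZ f M (c : C) : abs_bounded f M ->
  abs_bounded (fun i => c * f i) (cn c * M).
Proof.
move=> fM A; under eq_bigr do rewrite cnM.
by rewrite -mulr_sumr ler_wpM2l // cn_ge0.
Qed.

Lemma abs_boundedD f g M N : abs_bounded f M -> abs_bounded g N ->
  abs_bounded (fun i => f i + g i) (M + N).
Proof.
move=> fM gN A; apply: le_trans (lerD (fM A) (gN A)).
by rewrite -big_split; apply: ler_sum => i _; exact: cnD.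
Qed.

End UnorderedSums.

Section Reindexing.
Variables (R : realType) (I J : choiceType) (f : I -> cplx R) (M : R).
Implicit Types (h : J -> I) (k : I -> J).

Lemma abs_bounded_inj h : injective h ->
  abs_bounded f M -> abs_bounded (fun j => f (h j)) M.
Proof.
move=> hi fM A; have := fM [fset h j | j in A]%fset.
by rewrite big_imfset //= => x y _ _; exact: hi.
Qed.

(** A finite set that is large enough for f is pulled back along [k]; any larger set of new indices
    has an image containing the old one. *)
Lemma sum_reindex h k :
  cancel h k -> cancel k h -> abs_bounded f M -> sum (fun j => f (h j)) = sum f.
Proof.
move=> hk kh fM; apply: cvg_lim => //.
apply/cvgrPdist_le => e e0; have /cvgrPdist_le /(_ e e0) [A _ AP] := abs_cvg fM.
exists [fset k i | i in A]%fset => // B /= AB.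
have -> : partial_sum (fun j => f (h j)) B = partial_sum f [fset h j | j in B]%fset.
  by rewrite !partial_sumE big_imfset //= => x y _ _; exact: (can_inj hk).
apply: AP => /=; apply/fsubsetP => i iA; apply/imfsetP; exists (k i) => //=.
by apply: (fsubsetP AB); apply/imfsetP; exists i.
Qed.
End Reindexing.

(** * Holomorphy of exponential series *)

Section Differentiability.
Variables (R : realType) (V : normedModType (cplx R)).
Local Notation C := (cplx R).

(** The quadratic bound makes the remainder little-o of h: M |h|^2 is at most e |h| once |h| is at
    most e / (M + 1), where the added 1 allows M = 0. The bound [B] serves the continuity of the
    candidate differential. *)
Lemma differentiable_remainder (f L : V -> C) (x : V) (B M : C) :
  0 <= B -> 0 <= M -> linear L ->
  (forall h, `|L h| <= B * `|h|) ->
  (forall h, `|h| <= 1 -> `|f (h + x) - (f x + L h)| <= M * `|h| ^+ 2) ->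
  differentiable f x.
Proof.
move=> B0 M0 Llin LB fM.
pose LM := GRing.isLinear.Build _ _ _ _ _ Llin.
pose L' : {linear V -> C} := HB.pack L LM.
have Lc : continuous L'.
  apply: bounded_linear_continuous; apply/linear_boundedP.
  exists B; split; first exact: ger0_real.
  by move=> y By h; apply: le_trans (LB h) _; rewrite ler_wpM2r // ltW.
have fL : f \o shift x = cst (f x) + L' +o_ 0 id.
  have M1 : 0 < M + 1 by rewrite ltr_wpDl.
  apply/eqaddoP => e e0; near=> h.
  rewrite !fctE /=.
  have h1 : `|h| <= 1 by near: h; exact: nbhs0_le.
  apply: (le_trans (fM _ h1)); rewrite expr2 mulrA ler_wpM2r //.
  apply: (@le_trans _ _ ((M + 1) * `|h|)); first by rewrite ler_wpM2r // lerDl.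
  rewrite mulrC -ler_pdivlMr //.
  by near: h; apply: nbhs0_le; rewrite divr_gt0.
by apply/diff_locallyP; rewrite (diff_unique Lc fL).
Unshelve. all: by end_near. Qed.

Variables (I : choiceType) (c : I -> C) (l : I -> V -> C) (b : I -> R).
Hypothesis b_ge0 : forall i, 0 <= b i.
Hypothesis l_linear : forall i, linear (l i).
Hypothesis l_bound : forall i h, `|l i h| <= rc (b i) * `|h|.
Hypothesis c_bound : forall r, exists M,
  abs_bounded (fun i => c i * rc (expR (r * b i))) M.

Let nV (h : V) : R := complex.Re `|h|.
Lemma nVE h : `|h| = rc (nV h).
Proof.
have := normr_ge0 h; rewrite /nV; case: `|h| => a b' .
by rewrite lecE /= => /andP[/eqP -> _].
Qed.

Lemma cn_l i h : cn (l i h) <= b i * nV h.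
Proof. by rewrite -rc_le -cnE rmorphM /= -nVE. Qed.
Lemma nV_ge0 h : 0 <= nV h.
Proof. by rewrite -rc_le -nVE rmorph0. Qed.

Lemma Re_l i h : complex.Re (l i h) <= b i * nV h.
Proof. by apply: le_trans (cn_l i h); apply: le_trans (Re_le _); exact: ler_norm. Qed.

(** x^2 is at most (1 + x)^2, hence at most exp(x)^2. Squares of b_i are thus traded for a larger
    rate in [c_bound]. *)
Lemma sqr_le_expR (x : R) : 0 <= x -> x ^+ 2 <= expR (2 * x).
Proof.
move=> x0; rewrite (_ : 2 * x = x + x) ?expRD -?expr2; last by ring.
rewrite lerXn2r ?nnegrE ?expR_ge0 //.
by apply: le_trans (expR_ge1Dx x); rewrite lerDr.
Qed.

Lemma le_expR (x : R) : 0 <= x -> x <= expR x.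
Proof. by move=> x0; apply: le_trans (expR_ge1Dx x); rewrite lerDr. Qed.

Lemma exp_series_bounded (z : V) : exists M,
  abs_bounded (fun i => c i * expC (l i z)) M.
Proof.
have [M cM] := c_bound (nV z); exists M.
apply: abs_bounded_le cM => i; rewrite !cnM ler_wpM2l ?cn_ge0 //.
by rewrite cn_rc ger0_norm ?expR_ge0 // cn_expC ler_expR mulrC Re_l.
Qed.

Lemma differentiable_exp_series (z : V) :
  differentiable (fun y => sum (fun i => c i * expC (l i y))) z.
Proof.
(* In both rates [nV z] accounts for [expC (l i z)]. The 1 absorbs the factor b_i of the termwise
   differential. The 3 is 1 for the exponential in the Taylor bound at |h| <= 1, plus 2 for
   b_i^2. *)
have [M0 cM0] := c_bound (nV z + 1).
have [M1 cM1] := c_bound (nV z + 3).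
have [Mz cMz] := exp_series_bounded z.
(* The candidate differential is the series differentiated term by term. *)
pose T i h := c i * expC (l i z) * l i h.
have Tb h : abs_bounded (T^~ h) (M0 * nV h).
  move=> A; apply: le_trans (_ : \sum_(i <- A) cn (c i * rc (expR ((nV z + 1) * b i))) * nV h <= _).
    apply: ler_sum => i _; rewrite /T !cnM -mulrA -[leRHS]mulrA ler_wpM2l ?cn_ge0 //.
    rewrite cn_expC cn_rc ger0_norm ?expR_ge0 // mulrDl mul1r expRD.
    have e1 : expR (complex.Re (l i z)) <= expR (b i * nV z).
      by rewrite ler_expR; exact: Re_l.
    apply: le_trans (ler_pM (expR_ge0 _) (cn_ge0 _) e1 (cn_l i h)) _.
    rewrite mulrA ler_wpM2r ?nV_ge0 // [nV z * _]mulrC ler_wpM2l ?expR_ge0 //.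
    exact: le_expR.
  by rewrite -mulr_suml ler_wpM2r ?nV_ge0 //; exact: cM0.
have M0_ge0 : 0 <= M0 by have := cM0 fset0; rewrite big_seq_fset0.
have M1_ge0 : 0 <= M1 by have := cM1 fset0; rewrite big_seq_fset0.
apply: (@differentiable_remainder _ (fun h => sum (T^~ h)) z (rc M0) (rc (4 * M1))).
- by rewrite -(rmorph0 (@rc R)) rc_le.
- by rewrite -(rmorph0 (@rc R)) rc_le mulr_ge0.
- move=> a u v; change (sum (T^~ (a *: u + v)) = a * sum (T^~ u) + sum (T^~ v)).
  rewrite -(sumZ a (Tb u)) -(sumD (abs_boundedZ a (Tb u)) (Tb v)).
  congr summability.sum; apply/funext => i.
  by rewrite /T l_linear mulrDr [_ * (a *: _)]mulrCA.
- move=> h; rewrite cnE nVE -rmorphM rc_le; exact: sum_cn_le.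
move=> h h1; rewrite cnE nVE -rmorphXn -rmorphM rc_le.
have nh1 : nV h <= 1 by rewrite -rc_le -nVE rmorph1.
have [Mh cMh] := exp_series_bounded (h + z).
have := sumD cMz (Tb h) => <-.
have bD := abs_boundedD cMz (Tb h).
have := sumD cMh (abs_boundedZ (-1) bD).
rewrite (sumZ (-1) bD) mulN1r => <-.
apply: sum_cn_le => A.
apply: le_trans (_ : \sum_(i <- A) cn (c i * rc (expR ((nV z + 3) * b i))) * (4 * nV h ^+ 2) <= _).
  apply: ler_sum => i _; rewrite /T.
  have -> : l i (h + z) = l i h + l i z.
    by have := l_linear i 1 h z; rewrite !scale1r.
  rewrite expCD; set w := l i h; set E := expC (l i z).
  have -> : c i * (expC w * E) + -1 * (c i * E + c i * E * w) =
            c i * E * (expC w - 1 - w) by ring.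
  rewrite !cnM -mulrA -[leRHS]mulrA ler_wpM2l ?cn_ge0 //.
  rewrite cn_expC cn_rc ger0_norm ?expR_ge0 // mulrDl expRD -mulrA.
  apply: ler_pM; rewrite ?expR_ge0 ?cn_ge0 //.
    by rewrite ler_expR [leRHS]mulrC Re_l.
  apply: le_trans (expC_taylor2 w) _; rewrite [leRHS]mulrCA ler_wpM2l //.
  have wb : cn w <= b i by apply: le_trans (cn_l i h) _; rewrite ler_piMr.
  rewrite (_ : 3 * b i = b i + 2 * b i) ?expRD -?mulrA; last by ring.
  apply: ler_pM; rewrite ?expR_ge0 ?exprn_ge0 ?cn_ge0 ?ler_expR //.
  apply: (@le_trans _ _ (b i ^+ 2 * nV h ^+ 2)).
    by rewrite -exprMn lerXn2r ?nnegrE ?cn_ge0 ?mulr_ge0 ?nV_ge0 ?cn_l.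
  by rewrite ler_wpM2r ?exprn_ge0 ?nV_ge0 // sqr_le_expR.
rewrite -mulr_suml mulrA [4 * M1]mulrC ler_wpM2r ?exprn_ge0 ?nV_ge0 //.
by rewrite ler_wpM2r //; exact: cM1.
Qed.
End Differentiability.

Lemma near_differentiable (R : realType) (V : normedModType (cplx R))
    (f g : V -> cplx R) (x : V) :
  (\forall y \near x, f y = g y) -> differentiable g x -> differentiable f x.
Proof.
move=> fg dg.
have [e /= e0 fge] := (nbhs_ballP _ _).1 fg.
have fgx : f x = g x by apply: fge; exact: ballxx.
have fL : f \o shift x = cst (f x) + 'd g x +o_ 0 id.
  have /diff_locallyP[_ /eqaddoP gL] := dg.
  apply/eqaddoP => d d0; near=> h.
  have fgh : f (h + x) = g (h + x).
    apply: fge; rewrite -ball_normE /= opprD addrCA subrr addr0 normrN.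
    near: h; exact: nbhs0_lt.
  rewrite !fctE /= fgh fgx.
  change (`|(g \o shift x - (cst (g x) + 'd g x)) h| <= d * `|h|).
  near: h; exact: gL.
apply/diff_locallyP; rewrite (diff_unique (diff_continuous dg) fL).
by split => //; exact: diff_continuous dg.
Unshelve. all: by end_near. Qed.

(** * Division of an exponential series by a zero at the origin *)

Section SimpleZero.
Variables (R : realType) (I : choiceType).
Local Notation C := (cplx R).
Variables (c a : I -> C).
Hypothesis c_bound : forall r, exists M,
  abs_bounded (fun i => c i * rc (expR (r * cn (a i)))) M.
Local Notation F := (fun t => sum (fun i => c i * expC (a i * t))).
Hypothesis F0 : F 0 = 0.

Let a_linear i : linear (fun t : C => a i * t).
Proof. by move=> k u v; rewrite mulrDr [_ * (k *: u)]mulrCA. Qed.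

Let a_bound i (h : C) : `|a i * h| <= rc (cn (a i)) * `|h|.
Proof. by rewrite normrM cnE. Qed.

Lemma exp_series_simple_zero :
  exists2 h : C -> C, (forall t, differentiable h t) & forall t, F t = t * h t.
Proof.
have dF := differentiable_exp_series (fun i => cn_ge0 (a i)) a_linear a_bound c_bound.
have Fb := exp_series_bounded a_bound c_bound.
(* The termwise first and second Taylor coefficients of F at 0; the sums of [c1] and [c2] become the
   value and the derivative of the quotient at 0. *)
pose c1 i := c i * a i; pose c2 i := c i * a i ^+ 2 / 2.
have [M0 cM0] := Fb 0.
(* With b = |a_i|, the rate 4 serves the cubic remainder: 1 for its exponential at |u| <= 1, and 1 +
   2 for b^3 = b b^2. It also covers [c1] and [c2]. *)
have [M cM] := c_bound 4.
have M_ge0 : 0 <= M by have := cM fset0; rewrite big_seq_fset0.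
have c1M : abs_bounded c1 M.
  apply: abs_bounded_le cM => i; rewrite !cnM ler_wpM2l ?cn_ge0 //.
  rewrite cn_rc ger0_norm ?expR_ge0 //; apply: le_trans (le_expR (cn_ge0 _)) _.
  by rewrite ler_expR ler_peMl ?cn_ge0 // ler1n.
have c2M : abs_bounded c2 M.
  apply: abs_bounded_le cM => i; rewrite !cnM -mulrA ler_wpM2l ?cn_ge0 //.
  rewrite cn_rc ger0_norm ?expR_ge0 //.
  apply: (@le_trans _ _ (cn (a i) ^+ 2)).
    rewrite -expr2 ler_piMr ?sqr_ge0 //.
    rewrite (_ : 2^-1 = rc 2^-1) ?cn_rc ?ger0_norm ?invr_ge0 ?invf_le1 ?ler1n //.
    by rewrite fmorphV rmorph_nat.
  apply: le_trans (sqr_le_expR (cn_ge0 _)) _.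
  by rewrite ler_expR ler_wpM2r ?cn_ge0 // ler_nat.
(* Differentiability of h at 0 is the second-order expansion of F at 0, with
   remainder controlled by the cubic Taylor estimate of the exponential. *)
pose h t := if t == 0 then sum c1 else F t / t.
exists h => t; last first.
  by rewrite /h; case: eqP => [->|/eqP t0]; rewrite ?F0 ?mul0r // mulrC divfK.
have [->|t0] := eqVneq t 0; last first.
  apply: (@near_differentiable _ _ _ (fun t => F t * t^-1)).
    near=> y; rewrite /h ifF //; apply/eqP; near: y.
    apply/nbhs_ballP; exists `|t|; first by rewrite /= normr_gt0.
    by move=> y; rewrite -ball_normE /= => /[swap] ->; rewrite subr0 ltxx.
  apply: differentiableM; first exact: dF.
  exact: differentiable_Rinv.
apply: (@differentiable_remainder _ _ _ (fun u => sum c2 * u) 0 (rc (cn (sum c2))) (rc (5 * M))).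
- by rewrite -cnE.
- by rewrite -(rmorph0 (@rc R)) rc_le mulr_ge0.
- by move=> k u v; rewrite mulrDr [_ * (k *: u)]mulrCA.
- by move=> u; rewrite normrM cnE.
move=> u u1; rewrite addr0 {2}/h eqxx /h.
case: eqP => [->|/eqP u0].
  by rewrite mulr0 addr0 subrr normr0 mulr_ge0 // ?expr0n //= -(rmorph0 (@rc R)) rc_le mulr_ge0.
have nu0 : 0 < `|u| by rewrite normr_gt0.
(* Multiplying by |u| clears the quotient: the quadratic bound wanted for h becomes a cubic bound
   for F. *)
rewrite -(ler_pM2r nu0) -normrM mulrBl mulrDl divfK // -[leRHS]mulrA -exprSr.
rewrite !cnE -rmorphXn -rmorphM rc_le.
have cu1 : cn u <= 1 by move: u1; rewrite cnE -(rmorph1 (@rc R)) rc_le.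
have [Mu cMu] := Fb u.
pose r i := c i * (expC (a i * u) - 1 - a i * u - (a i * u) ^+ 2 / 2).
have rM : abs_bounded r (5 * M * cn u ^+ 3).
  move=> A.
  apply: (@le_trans _ _ (\sum_(i <- A)
      cn (c i * rc (expR (4 * cn (a i)))) * (5 * cn u ^+ 3))).
    apply: ler_sum => i _; rewrite /r !cnM -mulrA ler_wpM2l ?cn_ge0 //.
    apply: le_trans (expC_taylor3 _) _; rewrite [leRHS]mulrCA ler_wpM2l //.
    rewrite cn_rc (ger0_norm (expR_ge0 _)) cnM exprMn mulrA ler_wpM2r ?exprn_ge0 ?cn_ge0 //.
    rewrite (_ : 4 * cn (a i) = cn (a i) + (cn (a i) + 2 * cn (a i))); last by ring.
    rewrite !expRD; apply: ler_pM; rewrite ?expR_ge0 ?exprn_ge0 ?cn_ge0 //.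
      by rewrite ler_expR ler_piMr ?cn_ge0.
    rewrite exprS; apply: ler_pM; rewrite ?exprn_ge0 ?cn_ge0 ?le_expR ?cn_ge0 //.
    by rewrite sqr_le_expR ?cn_ge0.
  by rewrite -mulr_suml mulrA [5 * M]mulrC -!mulrA ler_wpM2r ?mulr_ge0 ?exprn_ge0 ?cn_ge0.
suff -> : F u - (sum c1 * u + sum c2 * u * u) = sum r by exact: sum_cn_le.
have b1 := abs_boundedZ u c1M; have b2 := abs_boundedZ (u * u) c2M.
have b3 := abs_boundedD (abs_boundedD cM0 b1) b2.
have e1 := sumD (abs_boundedD cM0 b1) b2; rewrite (sumD cM0 b1) F0 add0r in e1.
rewrite (sumZ u c1M) (sumZ (u * u) c2M) in e1.
have e2 := sumD cMu (abs_boundedZ (-1) b3); rewrite (sumZ (-1) b3) e1 in e2.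
rewrite -mulrA [_ * u]mulrC [sum c2 * _]mulrC -[- _]mulN1r -e2.
congr summability.sum; apply/funext => i.
rewrite /r /c1 /c2 mulr0 expC0 expr2; ring.
Unshelve. all: by end_near. Qed.
End SimpleZero.

(** * Gaussian sums *)

Section GaussianSums.
Variable R : realType.

(** The subtracted term carries the induction: the two new end terms add 2^-N, which is exactly the
    growth of the right-hand side. *)
Lemma sum_pow2 (N : nat) :
  \sum_(i < N.*2.+1) (2^-1 : R) ^+ `|(i : nat)%:Z - N%:Z|%N <= 3 - 2 * 2^-1 ^+ N.
Proof.
elim: N => [|N IH].
  by rewrite big_ord_recl big_ord0 /= !expr0; lra.
rewrite doubleS big_ord_recl big_ord_recr /=.
rewrite (eq_bigr (fun i : 'I_(N.*2.+1) => (2^-1 : R) ^+ `|(i : nat)%:Z - N%:Z|%N)); last first.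
  by move=> i _; congr (_ ^+ _); rewrite /bump /=; lia.
rewrite subn0.
have -> : `|(bump 0 N.*2.+1)%:Z - N.+1%:Z|%N = N.+1 by rewrite /bump /=; lia.
move: IH; rewrite exprS; move: (2^-1 ^+ N) => u; lra.
Qed.

(** A lies in a cube of side [-N, N]. The sum over the whole cube factors into m one-dimensional
    sums, each at most 3. The maps [h] and [h'] encode the cube by finite functions so that sum and
    product can be exchanged. *)
Lemma sum_prod_pow2 (m : nat) (A : {fset 'cV[int]_m}) :
  \sum_(k <- A) \prod_j (2^-1 : R) ^+ `|k j 0%R|%N <= 3 ^+ m.
Proof.
pose N := \max_(k <- A) \max_j `|k j 0%R|%N.
pose h (f : {ffun 'I_m -> 'I_(N.*2.+1)}) : 'cV[int]_m := \col_j ((f j : nat)%:Z - N%:Z).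
pose h' (k : 'cV[int]_m) : {ffun 'I_m -> 'I_(N.*2.+1)} := [ffun j => inord `|(k j 0%R + N%:Z)%R|%N].
have h'K k : k \in A -> h (h' k) = k.
  move=> kA; apply/colP => j; rewrite !mxE ffunE.
  have kN : (`|k j 0%R| <= N)%N.
    apply: leq_trans (_ : \max_j `|k j 0%R|%N <= _)%N.
      exact: (@leq_bigmax _ (fun j => `|k j 0%R|%N)).
    by rewrite /N (big_rem k) //= leq_maxl.
  by move: (k j 0) kN => x kN; rewrite inordK; lia.
rewrite (eq_big_seq (fun k => \prod_j (2^-1 : R) ^+ `|h (h' k) j 0%R|%N)); last first.
  by move=> k kA /=; rewrite h'K.
rewrite -(big_map h' xpredT (fun f => \prod_j (2^-1 : R) ^+ `|h f j 0%R|%N)).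
rewrite big_uniq /=; last first.
  rewrite map_inj_in_uniq; first exact: fset_uniq.
  by move=> x y xA yA /(congr1 h); rewrite !h'K.
apply: (@le_trans _ _ (\sum_f \prod_j (2^-1 : R) ^+ `|h f j 0%R|%N)).
  rewrite [leRHS](bigID (mem [seq h' i | i <- A])) /= lerDl.
  by apply: sumr_ge0 => f _; apply: prodr_ge0 => j _; rewrite exprn_ge0 ?invr_ge0.
under eq_bigr => f _ do under eq_bigr => j _ do rewrite mxE.
rewrite -(bigA_distr_bigA (fun (j : 'I_m) (i : 'I_(N.*2.+1)) =>
   (2^-1 : R) ^+ `|(i : nat)%:Z - N%:Z|%N)) /=.
rewrite -[m in leRHS](card_ord m) -prodr_const.
apply: ler_prod => j _; rewrite sumr_ge0 => [/=|i _]; last by rewrite exprn_ge0 ?invr_ge0.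
apply: le_trans (sum_pow2 N) _.
have : 0 <= (2^-1 : R) ^+ N by rewrite exprn_ge0 ?invr_ge0.
by lra.
Qed.

Definition qform m (Q : 'M[R]_m) (x : 'cV[R]_m) : R := (x^T *m Q *m x) 0 0.

(** On a kernel vector the form takes the value 0. *)
Lemma posdef_unitmx m (Q : 'M[R]_m) :
  (forall x, x != 0 -> 0 < qform Q x) -> Q \in unitmx.
Proof.
move=> Qpos; rewrite -row_free_unit -kermx_eq0; apply/rowV0P => v /sub_kermxP vQ.
apply: contrapT => /eqP v0.
have := Qpos v^T; rewrite /qform trmxK vQ mul0mx mxE ltxx.
by rewrite -trmx0 (inj_eq trmx_inj) v0 => /(_ isT).
Qed.

(* Since x_j = (Q^-1 e_j)^T Q x, Cauchy-Schwarz for the form Q bounds x_j^2 by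
   (Q^-1)_jj times the value of the form at x. *)
Lemma posdef_coord_bound m (Q : 'M[R]_m) : Q^T = Q ->
  (forall x, x != 0 -> 0 < qform Q x) ->
  exists2 c, 0 < c & forall x : 'cV[R]_m, \sum_j x j 0 ^+ 2 <= c * qform Q x.
Proof.
move=> Qs Qpos.
have Qu := posdef_unitmx Qpos.
have q_ge0 x : 0 <= qform Q x.
  have [->|/Qpos/ltW //] := eqVneq x 0.
  by rewrite /qform trmx0 !mul0mx mxE.
pose w j : 'cV[R]_m := invmx Q *m delta_mx j 0.
have wx j (x : 'cV[R]_m) : ((w j)^T *m Q *m x) 0 0 = x j 0.
  rewrite /w trmx_mul trmx_inv Qs mulmxKV // trmx_delta.
  by rewrite -rowE mxE.
have CS j (x : 'cV[R]_m) : x j 0 ^+ 2 <= qform Q (w j) * qform Q x.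
  have [w0|w0] := eqVneq (w j) 0.
    by rewrite -wx w0 trmx0 !mul0mx mxE expr0n mulr_ge0.
  have qw := Qpos _ w0.
  (* The form at this vector is the Cauchy-Schwarz defect multiplied by [qform Q (w j)], which is
     positive here. *)
  have := q_ge0 (qform Q (w j) *: x - x j 0 *: w j).
  have -> : qform Q (qform Q (w j) *: x - x j 0 *: w j) =
    qform Q (w j) * (qform Q (w j) * qform Q x - x j 0 ^+ 2).
    have xw : (x^T *m Q *m w j) 0 0 = x j 0.
      rewrite -wx -[in RHS](trmxK x) -[in RHS]Qs -mulmxA -!trmx_mul.
      by rewrite [RHS]mxE.
    have B00 (A B : 'M[R]_1) : (A - B) 0 0 = A 0 0 - B 0 0 by rewrite !mxE.
    have Z00 (s : R) (A : 'M[R]_1) : (s *: A) 0 0 = s * A 0 0 by rewrite !mxE.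
    rewrite {1}/qform [(_ - _)^T]linearB /= ![(_ *: _)^T]linearZ /=.
    rewrite !mulmxBl !mulmxBr -!scalemxAl -!scalemxAr !(B00, Z00) wx xw -!/(qform _ _).
    ring.
  by rewrite pmulr_rge0 // subr_ge0.
pose c := 1 + \sum_j qform Q (w j).
exists c => [|x]; first by rewrite /c ltr_wpDr // sumr_ge0.
rewrite /c mulrDl mul1r ler_wpDl // mulr_suml.
by apply: ler_sum => j _; exact: CS.
Qed.

(** The form dominates a multiple of the sum of squares, so the estimate is made coordinate by
    coordinate. There the Gaussian is replaced by exp(- |v_j|), hence up to a constant by exp(-
    |k_j|), which is at most 2^-|k_j|. *)
Lemma gaussian_sum_bounded m (Q : 'M[R]_m) (a : 'cV[R]_m) (t r : R) :
  Q^T = Q -> (forall x, x != 0 -> 0 < qform Q x) -> 0 < t ->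
  exists M, forall A : {fset 'cV[int]_m},
    \sum_(k <- A) expR (- t * qform Q (map_mx intr k + a)
                        + r * \sum_j `|(map_mx intr k + a) j 0|) <= M.
Proof.
move=> Qs Qpos t0; have [c c0 cQ] := posdef_coord_bound Qs Qpos.
pose del := t / c; have del0 : 0 < del by rewrite divr_gt0.
(* The maximum over s of - del s^2 + (r + 1) s: one extra unit beyond r leaves the decay exp(-
   s). *)
pose E := (r + 1) ^+ 2 / (4 * del).
pose B := expR (\sum_j (E + `|a j 0|)).
exists (B * 3 ^+ m) => A.
apply: (@le_trans _ _ (\sum_(k <- A) B * \prod_j (2^-1 : R) ^+ `|k j 0%R|%N)); last first.
  by rewrite -mulr_sumr ler_wpM2l ?expR_ge0 // sum_prod_pow2.
apply: ler_sum => k _; set v := _ + a.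
apply: (@le_trans _ _ (expR (\sum_j (- del * v j 0 ^+ 2 + r * `|v j 0|)))).
  rewrite ler_expR big_split /= -!mulr_sumr lerD2r !mulNr lerN2.
  by rewrite /del -mulrA ler_wpM2l ?(ltW t0) // mulrC ler_pdivrMr // mulrC.
have pw n : (2^-1 : R) ^+ n >= expR (- n%:R).
  rewrite -[n%:R]mulr1 -mulrN expRM_natl lerXn2r ?nnegrE ?expR_ge0 ?invr_ge0 //.
  rewrite expRN lef_pV2 ?posrE ?expR_gt0 //.
  by apply: le_trans (expR_ge1Dx 1); lra.
apply: (@le_trans _ _ (B * expR (\sum_j (- (`|k j 0%R|%N)%:R)))); last first.
  rewrite ler_wpM2l ?expR_ge0 // expR_sum.
  by apply: ler_prod => j _; rewrite expR_ge0 pw.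
rewrite /B -expRD ler_expR -big_split /=; apply: ler_sum => j _.
have vk : `|k j 0%R|%N%:R <= `|v j 0| + `|a j 0|.
  have -> : (`|k j 0%R|%N%:R : R) = `|v j 0 - a j 0|.
    by rewrite /v !mxE addrK -intr_norm natr_absz.
  exact: ler_normB.
have : - del * v j 0 ^+ 2 + r * `|v j 0| <= E - `|v j 0|.
  rewrite lerBrDr /E ler_pdivlMr ?pmulr_rgt0 ?invr_gt0 //.
  rewrite -[v j 0 ^+ 2]real_normK ?num_real //; move: `|v j 0| => s.
  by have := sqr_ge0 (2 * del * s - (r + 1)); nra.
by move: vk; lra.
Qed.
End GaussianSums.

(** * Theta functions *)

Section Dot.
Variables (R : realType) (m : nat).
Local Notation C := (cplx R).
Implicit Types (a b z : 'cV[C]_m) (M : 'M[C]_m).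

Lemma dotE a b : dot a b = \sum_i a i 0 * b i 0.
Proof. by rewrite /dot mxE; apply: eq_bigr => i _; rewrite mxE. Qed.
Lemma dotC a b : dot a b = dot b a.
Proof. by rewrite !dotE; apply: eq_bigr => i _; rewrite mulrC. Qed.
Lemma dotDr a b z : dot a (b + z) = dot a b + dot a z.
Proof. by rewrite /dot mulmxDr mxE. Qed.
Lemma dotDl a b z : dot (a + b) z = dot a z + dot b z.
Proof. by rewrite dotC dotDr !(dotC z). Qed.
Lemma dotZr (c : C) a b : dot a (c *: b) = c * dot a b.
Proof. by rewrite /dot -scalemxAr mxE. Qed.
Lemma dotZl (c : C) a b : dot (c *: a) b = c * dot a b.
Proof. by rewrite dotC dotZr dotC. Qed.
Lemma dot_sym M a b : M^T = M -> dot a (M *m b) = dot b (M *m a).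
Proof. by move=> Ms; rewrite dotC /dot trmx_mul Ms mulmxA. Qed.
Lemma dot_int (k l : 'cV[int]_m) : exists n : int, dot (intmx R k) (intmx R l) = n%:~R.
Proof.
exists (\sum_i k i 0 * l i 0); rewrite dotE rmorph_sum /=.
by apply: eq_bigr => i _; rewrite !mxE rmorphM.
Qed.
Lemma dot_linear a : linear (dot a).
Proof. by move=> k u v; rewrite dotDr dotZr. Qed.

Lemma coord_norm_le z i : `|z i 0| <= `|z|.
Proof.
change (`|z i 0| <= mx_norm z); rewrite mx_normE.
rewrite -[leLHS]nngE num_le.
exact: (le_bigmax _ (fun ij : 'I_m * 'I_1 => `|z ij.1 ij.2|%:nng) (i, 0)).
Qed.

Lemma dot_bound (v : 'cV[R]_m) z :
  `|dot (map_mx (@rc R) v) z| <= rc (\sum_i `|v i 0|) * `|z|.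
Proof.
rewrite dotE rmorph_sum mulr_suml; apply: le_trans (ler_norm_sum _ _ _) _.
apply: ler_sum => i _; rewrite normrM mxE cnE cn_rc ler_wpM2l ?coord_norm_le //.
by rewrite -(rmorph0 (@rc R)) rc_le.
Qed.
End Dot.

(** * Theta series with real characteristics *)

Section ThetaFunction.
Variables (R : realType) (tau : cplx R) (g : nat) (K : 'M[nat]_g.+1).
Local Notation C := (cplx R).
Hypotheses (tau_gt0 : 0 < complex.Im tau) (K_sym : K^T = K) (K_pos : posdef R K).
Implicit Types (a b : 'cV[R]_g.+1) (k l : 'cV[int]_g.+1) (z : 'cV[C]_g.+1).
Local Notation cmx := (map_mx (@rc R)).

Let KR : 'M[R]_g.+1 := map_mx (fun k : nat => k%:R) K.

Lemma natmx_rc : natmx R K = cmx KR.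
Proof. by apply/matrixP => i j; rewrite !mxE rmorph_nat. Qed.

Lemma natmx_sym : (natmx R K)^T = natmx R K.
Proof. by rewrite /natmx map_trmx K_sym. Qed.

Lemma Omega_sym : (Omega tau K)^T = Omega tau K.
Proof. by rewrite /Omega linearZ /= natmx_sym. Qed.

Lemma dot_Omega a : dot (cmx a) (Omega tau K *m cmx a) = tau * rc (qform KR a).
Proof.
rewrite /Omega -scalemxAl dotZr; congr (_ * _).
by rewrite /dot natmx_rc map_trmx -!map_mxM mxE mulmxA.
Qed.

Lemma intmx_rc k : intmx R k = cmx (map_mx intr k).
Proof. by apply/matrixP => i j; rewrite !mxE rmorph_int. Qed.

Definition theta_vec a k : 'cV[R]_g.+1 := map_mx intr k + a.

Lemma theta_vecE a k : intmx R k + cmx a = cmx (theta_vec a k).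
Proof. by rewrite intmx_rc /theta_vec map_mxD. Qed.

(** The term of index k is split as c_k exp(l_k(z)). Taking the characteristic real makes the
    quadratic exponent of c_k equal to pi i tau times a real number, so that |c_k| is a Gaussian. *)
Definition theta_coef a k : C :=
  expC (piC R * iC R * dot (cmx (theta_vec a k)) (Omega tau K *m cmx (theta_vec a k))).
Definition theta_exp a k z : C :=
  2 * piC R * iC R * dot (cmx (theta_vec a k)) z.

Lemma cn_theta_coef a k :
  cn (theta_coef a k) = expR (- (pi * complex.Im tau) * qform KR (theta_vec a k)).
Proof.
rewrite cn_expC dot_Omega; congr expR.
case: tau => x y /=; move: (qform _ _) => q; ring.
Qed.

Lemma theta_coef_bounded a r : exists M, abs_bounded
  (fun k => theta_coef a k * rc (expR (r * (2 * pi * \sum_i `|theta_vec a k i 0|)))) M.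
Proof.
have KRs : KR^T = KR by rewrite /KR map_trmx K_sym.
have [|M HM] := @gaussian_sum_bounded R _ KR a (pi * complex.Im tau) (r * (2 * pi)) KRs K_pos.
  by rewrite mulr_gt0 ?pi_gt0.
exists M => A; apply: le_trans (HM A); apply: ler_sum => k _.
by rewrite cnM cn_theta_coef cn_rc ger0_norm ?expR_ge0 // -expRD -/(theta_vec a k) mulrA.
Qed.

Lemma theta_exp_bound a k z :
  `|theta_exp a k z| <= rc (2 * pi * \sum_i `|theta_vec a k i 0|) * `|z|.
Proof.
rewrite /theta_exp normrM rmorphM /= -[leRHS]mulrA ler_pM ?dot_bound //.
by rewrite cnE rc_le !cnM cn_iC mulr1 piCE cn_rc -(rmorph_nat (@rc R)) cn_rc !ger0_norm ?pi_ge0.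
Qed.

Lemma theta_exp_linear a k : linear (theta_exp a k).
Proof.
by move=> c u v; rewrite /theta_exp dot_linear mulrDr [_ * (c *: _)]mulrCA.
Qed.

Lemma ThetaE a z :
  Theta (cmx a) 0 z (Omega tau K) = sum (fun k => theta_coef a k * expC (theta_exp a k z)).
Proof.
rewrite /Theta; congr summability.sum; apply/funext => k /=.
by rewrite theta_vecE expCD addr0.
Qed.

Lemma Theta_bounded a z : exists M,
  abs_bounded (fun k => theta_coef a k * expC (theta_exp a k z)) M.
Proof.
exact: (exp_series_bounded (theta_exp_bound a) (theta_coef_bounded a)).
Qed.

Lemma Theta_holomorphic a : holomorphic (fun z => Theta (cmx a) 0 z (Omega tau K)).
Proof.
move=> z.
rewrite (_ : (fun z => _) = fun z =>
    sum (fun k => theta_coef a k * expC (theta_exp a k z))).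
  apply: (differentiable_exp_series _ (theta_exp_linear a) (theta_exp_bound a)).
    by move=> k; rewrite !mulr_ge0 ?pi_ge0 ?sumr_ge0.
  exact: theta_coef_bounded.
by apply/funext => y; rewrite ThetaE.
Qed.

Lemma Theta_shift_int a l z : Theta (cmx a) 0 (z + intmx R l) (Omega tau K) =
  expC (2 * piC R * iC R * dot (cmx a) (intmx R l)) * Theta (cmx a) 0 z (Omega tau K).
Proof.
have [M aM] := Theta_bounded a z.
rewrite !ThetaE -(sumZ _ aM); congr summability.sum; apply/funext => k.
rewrite [RHS]mulrCA; congr (_ * _); rewrite -expCD.
rewrite /theta_exp -theta_vecE dotDr mulrDr !dotDl.
have [n ->] := dot_int R k l.
by rewrite [_ * (n%:~R + _)]mulrDr !expCD expC_2pi_int mul1r mulrC.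
Qed.

(** Completing the square in v + b, with Omega symmetric, matches the two series term by term. The
    summation index is not moved, so b may be any real vector and not only an integral one. *)
Lemma Theta_shift_Omega a b z :
  Theta (cmx a) 0 (z + Omega tau K *m cmx b) (Omega tau K) =
  expC (- (piC R * iC R * dot (cmx b) (Omega tau K *m cmx b + 2 *: z))) *
  Theta (cmx (a + b)) 0 z (Omega tau K).
Proof.
have [M aM] := Theta_bounded (a + b) z.
rewrite !ThetaE -(sumZ _ aM); congr summability.sum; apply/funext => k.
rewrite /theta_coef /theta_exp -[in LHS]expCD -[X in _ = _ * X]expCD -[RHS]expCD.
congr expC.
have -> : theta_vec (a + b) k = theta_vec a k + b by rewrite /theta_vec addrA.
rewrite (_ : cmx (theta_vec a k + b) = cmx (theta_vec a k) + cmx b); last exact: map_mxD.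
move: (cmx (theta_vec a k)) (cmx b) => v w.
rewrite !(dotDl, dotDr, mulmxDr) dotZr (dot_sym v w Omega_sym).
ring.
Qed.

Lemma Theta_char_int a l z :
  Theta (cmx (a + map_mx intr l)) 0 z (Omega tau K) = Theta (cmx a) 0 z (Omega tau K).
Proof.
have [M aM] := Theta_bounded a z.
have lK : cancel (fun k => k + l) (fun k => k - l) by move=> k; rewrite addrK.
have lK' : cancel (fun k => k - l) (fun k => k + l) by move=> k; rewrite subrK.
have E k : theta_vec (a + map_mx intr l) k = theta_vec a (k + l).
  by rewrite /theta_vec map_mxD [a + _]addrC addrA.
have Ef : (fun k => theta_coef (a + map_mx intr l) k * expC (theta_exp (a + map_mx intr l) k z))
    = fun k => theta_coef a (k + l) * expC (theta_exp a (k + l) z).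
  by apply/funext => k; rewrite /theta_coef /theta_exp E.
rewrite ThetaE Ef; apply: etrans (sum_reindex lK lK' aM) _.
by rewrite ThetaE.
Qed.
End ThetaFunction.

Lemma differentiable_expC (R : realType) (z : cplx R) : differentiable (@expC R) z.
Proof.
apply: (@differentiable_remainder _ _ _ (fun u => expC z * u) z (rc (cn (expC z)))
  (rc (cn (expC z) * (4 * expR 1)))).
- by rewrite -cnE.
- by rewrite -(rmorph0 (@rc R)) rc_le !mulr_ge0 ?cn_ge0 ?expR_ge0.
- by move=> k u v; rewrite mulrDr [_ * (k *: u)]mulrCA.
- by move=> u; rewrite normrM cnE.
move=> u u1; have cu1 : cn u <= 1 by move: u1; rewrite cnE -(rmorph1 (@rc R)) rc_le.
have -> : expC (u + z) - (expC z + expC z * u) = expC z * (expC u - 1 - u).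
  by rewrite expCD; ring.
rewrite !cnE -rmorphXn -rmorphM rc_le cnM -mulrA ler_wpM2l ?cn_ge0 //.
apply: le_trans (expC_taylor2 u) _; rewrite -mulrA ler_wpM2l //.
by rewrite ler_wpM2r ?exprn_ge0 ?cn_ge0 // ler_expR.
Qed.

Section FunctionwiseDifferentiability.
Variables (R : realType) (V : normedModType (cplx R)).
Local Notation C := (cplx R).
Implicit Types (f g : V -> C) (x : V).

Lemma diff_add f g x : differentiable f x -> differentiable g x ->
  differentiable (fun y => f y + g y) x.
Proof. exact: differentiableD. Qed.
Lemma diff_sub f g x : differentiable f x -> differentiable g x ->
  differentiable (fun y => f y - g y) x.
Proof. exact: differentiableB. Qed.
Lemma diff_mul f g x : differentiable f x -> differentiable g x ->
  differentiable (fun y => f y * g y) x.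
Proof. exact: differentiableM. Qed.
Lemma diff_const (c : C) x : differentiable (fun=> c) x.
Proof. exact: differentiable_cst. Qed.
Lemma diff_exp f n x : differentiable f x -> differentiable (fun y => f y ^+ n) x.
Proof.
move=> df; elim: n => [|n IH]; first by under eq_fun do rewrite expr0; exact: diff_const.
by under eq_fun do rewrite exprS; exact: diff_mul.
Qed.
Lemma diff_prod (I : Type) (r : seq I) (P : pred I) (F : I -> V -> C) x :
  (forall i, P i -> differentiable (F i) x) ->
  differentiable (fun y => \prod_(i <- r | P i) F i y) x.
Proof.
move=> dF; elim: r => [|i r IH].
  by under eq_fun do rewrite big_nil; exact: diff_const.
under eq_fun do rewrite big_cons.
by case Pi: (P i); [exact: diff_mul (dF i Pi) IH | exact: IH].
Qed.
Lemma diff_sum (I : Type) (r : seq I) (P : pred I) (F : I -> V -> C) x :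
  (forall i, P i -> differentiable (F i) x) ->
  differentiable (fun y => \sum_(i <- r | P i) F i y) x.
Proof.
move=> dF; elim: r => [|i r IH].
  by under eq_fun do rewrite big_nil; exact: diff_const.
under eq_fun do rewrite big_cons.
by case Pi: (P i); [exact: diff_add (dF i Pi) IH | exact: IH].
Qed.
Lemma diff_compC (h : C -> C) f x : differentiable h (f x) ->
  differentiable f x -> differentiable (fun y => h (f y)) x.
Proof. by move=> dh df; exact: (differentiable_comp df dh). Qed.
Lemma diff_id (t : C) : differentiable (fun y : C => y) t.
Proof. exact: (@ex_diff _ _ _ _ _ _ _ (is_diff_id t)). Qed.
End FunctionwiseDifferentiability.

(** * The odd theta function: quasi-periods and zeros *)

Section Vartheta.
Variables (R : realType) (tau : cplx R).
Local Notation C := (cplx R).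
Hypothesis tau_gt0 : 0 < complex.Im tau.
Local Notation pii := (piC R * iC R).

Let v (k : int) : C := k%:~R + 2^-1.
(** The 1/2 in z + 1/2 contributes pi i v_k to the exponent; it is independent of z and therefore
    moved into the coefficient. *)
Let coef k : C := expC (pii * tau * v k ^+ 2 + pii * v k).
Let freq k : C := 2 * pii * v k.

Let half_rc : (2^-1 : C) = rc 2^-1.
Proof. by rewrite fmorphV rmorph_nat. Qed.

Let v_rc k : v k = rc (k%:~R + 2^-1).
Proof. by rewrite /v rmorphD rmorph_int half_rc. Qed.

Let two_pii_half : 2 * pii * 2^-1 = pii.
Proof. by rewrite mulrAC divff ?mul1r // pnatr_eq0. Qed.

Lemma varthetaE z : vartheta tau z = sum (fun k => coef k * expC (freq k * z)).
Proof.
rewrite /vartheta; congr summability.sum; apply/funext => k /=.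
rewrite /coef /freq -expCD -/(v k); congr expC.
by field.
Qed.

(** The one-dimensional Gaussian sum for the form x^2 with offset 1/2, integers being embedded as 1
    x 1 columns. *)
Let coef_bounded r : exists M,
  abs_bounded (fun k => coef k * rc (expR (r * cn (freq k)))) M.
Proof.
have Q1 : (1%:M : 'M[R]_1)^T = 1%:M by rewrite trmx1.
have qE (x : 'cV[R]_1) : qform 1%:M x = x 0 0 ^+ 2.
  by rewrite /qform mulmx1 mxE big_ord1 mxE expr2.
have Qpos (x : 'cV[R]_1) : x != 0 -> 0 < qform 1%:M x.
  move=> x0; rewrite qE exprn_even_gt0 //=; apply: contra x0 => /eqP x0.
  by apply/eqP/colP => i; rewrite (ord1 i) x0 mxE.
have [|M HM] := @gaussian_sum_bounded R 1 1%:M (const_mx 2^-1)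
  (pi * complex.Im tau) (r * (2 * pi)) Q1 Qpos.
  by rewrite mulr_gt0 ?pi_gt0.
exists M => A.
have inj : injective (fun k : int => const_mx k : 'cV[int]_1).
  by move=> k l /matrixP /(_ 0 0); rewrite !mxE.
have := HM [fset (const_mx k : 'cV[int]_1) | k in A]%fset.
rewrite big_imfset /= => [|x y _ _]; last exact: inj.
apply: le_trans; apply: ler_sum => k _.
rewrite qE big_ord1 !mxE cnM cn_expC cn_rc ger0_norm ?expR_ge0 // -expRD ler_expR.
have -> : cn (freq k) = 2 * pi * `|k%:~R + 2^-1|.
  rewrite /freq v_rc !cnM cn_iC mulr1 piCE -(rmorph_nat (@rc R)) !cn_rc.
  by rewrite (ger0_norm (pi_ge0 R)) (@ger0_norm _ 2).
rewrite lerD // -?mulrA // v_rc; case: (tau) => x y /=.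
move: (k%:~R + 2^-1) => s; rewrite le_eqVlt; apply/orP; left; apply/eqP; ring.
Qed.

Let freq_linear k : linear (fun t : C => freq k * t).
Proof. by move=> c u w; rewrite mulrDr [_ * (c *: u)]mulrCA. Qed.

Let freq_bound k (h : C) : `|freq k * h| <= rc (cn (freq k)) * `|h|.
Proof. by rewrite normrM cnE. Qed.

Let vartheta_bounded z : exists M, abs_bounded (fun k => coef k * expC (freq k * z)) M.
Proof. exact: (exp_series_bounded freq_bound coef_bounded). Qed.

Lemma vartheta_holomorphic z : differentiable (vartheta tau) z.
Proof.
rewrite (_ : vartheta tau = fun z => sum (fun k => coef k * expC (freq k * z))).
  exact: (differentiable_exp_series (fun k => cn_ge0 (freq k)) freq_linear freq_bound coef_bounded).
by apply/funext => y; rewrite varthetaE.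
Qed.

Let expC_freq k : expC (freq k) = -1.
Proof. by rewrite /freq /v mulrDr two_pii_half expCD mulrA expC_2pi_int mul1r expC_pi. Qed.

Lemma vartheta_shift1 z : vartheta tau (z + 1) = - vartheta tau z.
Proof.
have [M bM] := vartheta_bounded z.
rewrite !varthetaE -mulN1r -(sumZ _ bM); congr summability.sum; apply/funext => k.
by rewrite mulrDr mulr1 expCD expC_freq mulrN1 mulrN mulN1r.
Qed.

(** Term k on the left is term k + 1 of the series at z times - phi(z), since 2 v_k + v_k^2 = (v_k +
    1)^2 - 1. The minus sign is exp(- pi i), from the phase pi i v_k. *)
Lemma vartheta_shift_tau z :
  vartheta tau (z + tau) = - phi tau z * vartheta tau z.
Proof.
have [M bM] := vartheta_bounded z.
have lK : cancel (fun k : int => k + 1) (fun k => k - 1) by move=> k; rewrite addrK.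
have lK' : cancel (fun k : int => k - 1) (fun k => k + 1) by move=> k; rewrite subrK.
have bM' := abs_bounded_inj (can_inj lK) bM; cbv beta in bM'.
rewrite !varthetaE -(sum_reindex lK lK' bM) -(sumZ _ bM').
congr summability.sum; apply/funext => k.
have expN : expC (- pii) = -1 by rewrite expCN expC_pi invrN invr1.
have -> : - phi tau z = expC (- pii - pii * tau - 2 * pii * z).
  by rewrite /phi -mulN1r -expN -expCD mulrA -addrA.
rewrite /coef /freq.
have -> : v (k + 1) = v k + 1 by rewrite /v rmorphD /= addrAC.
rewrite -!expCD; congr expC; ring.
Qed.

(** The involution k -> -1 - k sends v_k to - v_k. The phase exp(pi i v_k) is then inverted, that
    is, divided by exp(2 pi i v_k) = -1. *)
Lemma vartheta_odd z : vartheta tau (- z) = - vartheta tau z.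
Proof.
have [M bM] := vartheta_bounded z.
have lK : cancel (fun k : int => - 1 - k) (fun k => - 1 - k) by move=> k; rewrite opprB addrC subrK.
have bM' := abs_bounded_inj (can_inj lK) bM; cbv beta in bM'.
rewrite [in RHS]varthetaE -(sum_reindex lK lK bM) -[RHS]mulN1r -(sumZ _ bM') varthetaE.
congr summability.sum; apply/funext => k.
have vN : v (- 1 - k) = - v k.
  rewrite /v rmorphB rmorphN /=; apply/eqP; rewrite -subr_eq0; apply/eqP; by field.
rewrite -(expC_freq k) /coef /freq vN -!expCD; congr expC; ring.
Qed.

Lemma vartheta0 : vartheta tau 0 = 0.
Proof.
have := vartheta_odd 0; rewrite oppr0 => /eqP; rewrite -addr_eq0 -mulr2n mulrn_eq0 /=.
by move/eqP.
Qed.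

Lemma vartheta_lattice_zero lam : lattice tau lam ->
  exists2 h : C -> C, (forall t, differentiable h t) &
    forall t, vartheta tau t = (t - lam) * h t.
Proof.
pose P lam := exists2 h : C -> C, (forall t, differentiable h t) &
    forall t, vartheta tau t = (t - lam) * h t.
have dshift (h : C -> C) (s : C) : (forall t, differentiable h t) ->
    forall t, differentiable (fun t => h (t + s)) t.
  by move=> dh t; apply: (@diff_compC _ _ h (fun t => t + s)).
have P0 : P 0.
  have [|h dh hE] := exp_series_simple_zero coef_bounded; first by rewrite -varthetaE vartheta0.
  by exists h => // t; rewrite subr0 -hE varthetaE.
(* A quasi-period with non-vanishing entire multiplier e carries divisibility in both directions:
   the quotient is translated, then divided by e for x - s, or multiplied by the translate of e for
   x + s. *)
have step (s : C) (e : C -> C) :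
    (forall t, differentiable e t) -> (forall t, vartheta tau (t + s) = e t * vartheta tau t) ->
    (forall t, e t != 0) -> forall x, (P x -> P (x - s)) /\ (P x -> P (x + s)).
  move=> de eE e0 x; split=> -[h dh hE].
    exists (fun t => (e t)^-1 * h (t + s)) => t.
      apply: diff_mul; last exact: dshift.
      exact: differentiableV.
    apply: (mulfI (e0 t)); rewrite -eE hE mulrCA mulVKf // opprB addrA.
    by rewrite [t + s]addrC -addrA [s + _]addrC -!addrA.
  exists (fun t => e (t - s) * h (t - s)) => t.
    by apply: diff_mul; exact: dshift.
  by rewrite -{1}(subrK s t) eE hE mulrCA opprD addrA addrAC.
have iter_step (s : C) : (forall x, (P x -> P (x - s)) /\ (P x -> P (x + s))) ->
    forall x (k : int), P x -> P (x + k%:~R * s).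
  move=> st x k Px; elim/int_ind: k => [|n IH|n IH]; first by rewrite mul0r addr0.
    rewrite (_ : _ + _ = x + n%:~R * s + s); first exact: (st _).2 IH.
    by rewrite intS rmorphD /= mulrDl mul1r addrCA addrC.
  rewrite (_ : _ + _ = x + (- n%:Z)%:~R * s - s); first exact: (st _).1 IH.
  by rewrite intS opprD rmorphD /= mulrDl mulN1r addrCA addrC.
move=> [a [b ->]]; apply: (iter_step _).
  apply: (@step tau (fun t => - phi tau t)); last 1 first.
  - by move=> t; rewrite oppr_eq0 expC_neq0.
  - move=> t; apply: differentiableN.
    apply: (@diff_compC _ _ (@expC R)); first exact: differentiable_expC.
    by apply: diff_sub; [|apply: diff_mul; last exact: diff_id]; exact: diff_const.
  - exact: vartheta_shift_tau.
rewrite -[a%:~R]add0r -[a%:~R]mulr1; apply: (iter_step _) => //.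
apply: (@step 1 (fun=> -1)) => t; first exact: diff_const.
  by rewrite vartheta_shift1 mulN1r.
by rewrite oppr_eq0 oner_eq0.
Qed.
End Vartheta.

(** * Sections over X *)

Section PairProducts.
Variables (R : realType) (g : nat) (K : 'M[nat]_g.+1) (n : 'cV[nat]_g.+1).
Local Notation C := (cplx R).
Implicit Types (F G : cidx n -> cidx n -> C) (i j : cidx n).

(** Lexicographic order on the variables. It merges the two blocks of [pair_prod], equal and
    distinct first index, into one product over unordered pairs. *)
Definition cidx_lt i j : bool :=
  (tag i < tag j)%N || ((tag i == tag j) && (tagged i < tagged j)%N).

Lemma cidx_lt_total i j : (i != j) = cidx_lt i j || cidx_lt j i.
Proof.
case: i j => k p [l q]; rewrite /cidx_lt /=.
have [kl|kl|kl] := ltngtP k l.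
- by rewrite orTb; apply/eqP => E; move: kl; rewrite (congr1 tag E : k = l) ltnn.
- by rewrite orbT; apply/eqP => E; move: kl; rewrite (congr1 tag E : k = l) ltnn.
have E : k = l by apply: val_inj.
case: l / E q kl => q _; rewrite eqxx /= -neq_ltn.
by have /= -> := @eq_Tagged 'I_g.+1 (fun k => 'I_(n k ord0)) (ix p) q.
Qed.

Lemma cidx_lt_asym i j : cidx_lt i j -> cidx_lt j i = false.
Proof.
case: i j => k p [l q]; rewrite /cidx_lt /=.
rewrite [l == k]eq_sym; have [kl|kl|kl] := ltngtP k l => //=.
- by have /negbTE -> : k != l by apply/eqP => E; move: kl; rewrite E ltnn.
- by have /negbTE -> : k != l by apply/eqP => E; move: kl; rewrite E ltnn.
by move=> /andP[-> pq]; apply/negbTE; rewrite -leqNgt ltnW.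
Qed.

Lemma big_cidx (T : Type) (idx : T) (op : Monoid.com_law idx)
    (P : pred (cidx n)) (f : cidx n -> T) :
  \big[op/idx]_(j | P j) f j =
  \big[op/idx]_k \big[op/idx]_(p < n k ord0 | P (ix p)) f (ix p).
Proof.
rewrite (@sig_big_dep _ _ op 'I_g.+1 (fun k => 'I_(n k ord0)) xpredT
   (fun k p => P (ix p)) (fun k p => f (ix p))) /=.
by apply: eq_big => [[k p]|[k p] _].
Qed.

Lemma pair_prodE F : pair_prod K F =
  \prod_i \prod_(j | cidx_lt i j) F i j ^+ K (tag i) (tag j).
Proof.
rewrite big_cidx /pair_prod.
rewrite [X in _ * X](_ : _ = \prod_k \prod_(p < n k ord0) \prod_(l < g.+1 | (k < l)%N)
  \prod_(q < n l ord0) F (ix p) (ix q) ^+ K k l); last first.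
  by apply: eq_bigr => k _; rewrite exchange_big.
rewrite -big_split; apply: eq_bigr => k _; rewrite -big_split; apply: eq_bigr => p _ /=.
rewrite big_cidx [RHS](bigD1 k) //=; congr (_ * _).
  by apply: eq_bigl => q; rewrite /cidx_lt /= ltnn eqxx.
rewrite big_mkcond [RHS]big_mkcond; apply: eq_bigr => l _ /=.
have [->|lk] := eqVneq l k; first by rewrite ltnn.
case: ltnP => kl.
  by apply: eq_bigl => q; rewrite /cidx_lt /= kl.
rewrite big1 // => q; rewrite /cidx_lt /= ltnNge kl /=.
by rewrite eq_sym (negbTE lk).
Qed.

Lemma pair_prodM F G :
  pair_prod K (fun i j => F i j * G i j) = pair_prod K F * pair_prod K G.
Proof.
rewrite !pair_prodE -big_split; apply: eq_bigr => i _ /=.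
by rewrite -big_split; apply: eq_bigr => j _; rewrite exprMn.
Qed.

(* The factors acquired by the pairs (a, b) when only the variable z_i moves. *)
Definition star i (m : cidx n -> C) a b : C :=
  if a == i then (if b == i then 1 else m b) else if b == i then m a else 1.

(** Only pairs containing i contribute, and each j other than i occurs in exactly one of them, on
    one side or the other; the symmetry of K makes the exponent the same on both sides. *)
Lemma pair_prod_star i m : K^T = K ->
  pair_prod K (star i m) = \prod_(j | j != i) m j ^+ K (tag i) (tag j).
Proof.
move=> Ks; rewrite pair_prodE (bigD1 i) //=.
rewrite (eq_bigr (fun j => m j ^+ K (tag i) (tag j))); last first.
  move=> j ij; rewrite /star eqxx ifN //.
  by rewrite eq_sym cidx_lt_total ij.
rewrite [X in _ * X](eq_bigr (fun a =>
    if cidx_lt a i then m a ^+ K (tag a) (tag i) else 1)); last first.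
  move=> a ai; case: ifP => lt_ai.
    rewrite (bigD1 i) //= big1 ?mulr1 => [|b /andP[_ bi]]; first by rewrite /star (negbTE ai) eqxx.
    by rewrite /star (negbTE ai) (negbTE bi) expr1n.
  apply: big1 => b lt_ab; rewrite /star (negbTE ai) ifN ?expr1n //.
  by apply/eqP => E; rewrite -E lt_ab in lt_ai.
rewrite -big_mkcondr /= [RHS](bigID (cidx_lt i)) /=; congr (_ * _).
  apply: eq_bigl => j; case: (boolP (cidx_lt i j)) => ij; rewrite ?andbF // andbT.
  by rewrite eq_sym cidx_lt_total ij.
apply: eq_big => [j|j _]; last by rewrite -{1}Ks mxE.
rewrite eq_sym cidx_lt_total; case: (boolP (cidx_lt i j)) => ij.
  by rewrite cidx_lt_asym.
by rewrite /= andbT andbb.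
Qed.
End PairProducts.

(** * Quasi-periods of D and its divisibility along the diagonals *)

Section Sections.
Variables (R : realType) (tau : cplx R) (g : nat) (K : 'M[nat]_g.+1).
Variables (n : 'cV[nat]_g.+1) (d : nat).
Local Notation C := (cplx R).
Local Notation pt := 'cV[C]_#|cidx n|.
Local Notation pii := (piC R * iC R).
Hypotheses (tau_gt0 : 0 < complex.Im tau) (K_sym : K^T = K) (Kn : K *m n = const_mx d).
Hypothesis K_diag : (forall i, ~~ odd (K i i)) \/ (forall i, odd (K i i)).
Implicit Types (i j : cidx n) (z : pt) (xi : 'cV[C]_g.+1).

Lemma sum_cidx (f : 'I_g.+1 -> C) :
  \sum_(j : cidx n) f (tag j) = \sum_k (n k ord0)%:R * f k.
Proof.
rewrite big_cidx; apply: eq_bigr => k _.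
by rewrite /= sumr_const card_ord mulr_natl.
Qed.

Lemma coordD z z' i : coord (z + z') i = coord z i + coord z' i.
Proof. by rewrite /coord mxE. Qed.

Lemma coord_shift1 z i t j :
  coord (z + shift1 i t) j = coord z j + (if j == i then t else 0).
Proof.
rewrite coordD /coord !mxE eqxx andbT (inj_eq enum_rank_inj).
by case: eqP; rewrite ?mulr1 ?mulr0.
Qed.

Lemma coord_const z (c : C) i : coord (z + const_mx c) i = coord z i + c.
Proof. by rewrite coordD /coord mxE. Qed.

Lemma wvecE z k : wvec z k 0 = \sum_(j : cidx n | tag j == k) coord z j.
Proof.
rewrite big_cidx (bigD1 k) //= mxE [X in _ + X]big1 ?addr0 => [|l lk].
  by apply: eq_bigl => p; rewrite /= eqxx.
by apply: big_pred0 => p; rewrite /= (negbTE lk).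
Qed.

Lemma wvec_shift1 z i t :
  wvec (z + shift1 i t) = wvec z + t *: intmx R (delta_mx (tag i) 0).
Proof.
apply/colP => k; rewrite wvecE.
have -> : (wvec z + t *: intmx R (delta_mx (tag i) 0)) k 0 = wvec z k 0 + t * (k == tag i)%:R.
  by rewrite mxE; congr (_ + _); rewrite !mxE eqxx andbT; case: eqP.
under eq_bigr do rewrite coord_shift1.
rewrite big_split /= -wvecE; congr (_ + _).
rewrite -big_mkcondr; case: (eqVneq k (tag i)) => [->|ki].
  rewrite mulr1 (bigD1 i) ?eqxx //= big1 ?addr0 // => j.
  by move=> /andP[/andP[_ /eqP ->]]; rewrite eqxx.
rewrite mulr0 big_pred0 // => j; apply/negbTE; rewrite negb_and orbC.
by case: (eqVneq j i) => //= ->; rewrite eq_sym.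
Qed.

Lemma wvec_const z (c : C) : wvec (z + const_mx c) = wvec z + c *: natmx R n.
Proof.
apply/colP => k; rewrite !mxE; under eq_bigr do rewrite coord_const.
by rewrite big_split /= sumr_const card_ord mulr_natr.
Qed.

Lemma D_const z (c : C) : D tau K (z + const_mx c) = D tau K z.
Proof.
rewrite /D; congr (pair_prod K _); apply/funext => i; apply/funext => j.
by rewrite !coord_const opprD addrACA subrr addr0.
Qed.

(** Row [tag i] of K n = d e, with block l counted once for each of its n_l variables. *)
Lemma sum_K i : (\sum_(j : cidx n) K (tag i) (tag j) = d)%N.
Proof.
have /matrixP /(_ (tag i) ord0) := Kn; rewrite !mxE => <-.
rewrite big_cidx; apply: eq_bigr => k _.
by rewrite /= sum_nat_const card_ord mulnC.
Qed.

Lemma sum_K_neq i : (\sum_(j : cidx n | j != i) K (tag i) (tag j) = d - K (tag i) (tag i))%N.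
Proof. by rewrite -(sum_K i) [X in (X - _)%N](bigD1 i) //= addKn. Qed.

Lemma K_diag_le i : (K (tag i) (tag i) <= d)%N.
Proof. by rewrite -(sum_K i) (bigD1 i) //= leq_addr. Qed.

(** The total exponent is d - K_kk with k = [tag i]. Because the diagonal has constant parity, it
    has the parity of K_11 + d that decides between L and L^sharp. *)
Lemma prod_sign i :
  \prod_(j : cidx n | j != i) (-1) ^+ K (tag i) (tag j) = bundle_sign R K d.
Proof.
rewrite -(big_morph (fun m => (-1 : C) ^+ m) (exprD (-1 : C)) (expr0 _)).
rewrite sum_K_neq -signr_odd oddB ?K_diag_le //.
rewrite /bundle_sign oddD addbC.
have -> : odd (K (tag i) (tag i)) = odd (K ord0 ord0).
  by case: K_diag => H; [rewrite !(negbTE (H _)) | rewrite !H].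
by case: (_ (+) _).
Qed.

(** Stated for a general multiplier [m] to cover both t = 1 and t = tau. When z_i is the second
    variable of a pair, oddness of theta turns the factor around, so the multiplier is again - m(z_i
    - z_j). *)
Lemma D_shift z i t (m : C -> C) :
  (forall x, vartheta tau (x + t) = - m x * vartheta tau x) ->
  D tau K (z + shift1 i t) =
  bundle_sign R K d * (\prod_(j | j != i) m (coord z i - coord z j) ^+ K (tag i) (tag j))
  * D tau K z.
Proof.
move=> vt.
rewrite -(prod_sign i) -big_split /=.
rewrite (eq_bigr (fun j => (- m (coord z i - coord z j)) ^+ K (tag i) (tag j))); last first.
  by move=> j _; rewrite -exprMn mulN1r.
rewrite -(pair_prod_star i (fun j => - m (coord z i - coord z j)) K_sym) -pair_prodM.
rewrite /D; congr (pair_prod K _); apply/funext => a; apply/funext => b.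
rewrite !coord_shift1 /star; case: (eqVneq a i) => [->|ai]; case: (eqVneq b i) => [->|bi].
- by rewrite mul1r opprD addrACA !subrr addr0.
- by rewrite addr0 addrAC vt.
- have -> : coord z a + 0 - (coord z i + t) = - (coord z i - coord z a + t) by ring.
  by rewrite vartheta_odd // vt -(opprB (coord z i)) vartheta_odd // mulrN.
- by rewrite !addr0 mul1r.
Qed.

Lemma differentiable_colvec (V : normedModType C) m (f : V -> 'cV[C]_m) (x : V) :
  (forall k, differentiable (fun y => f y k 0) x) -> differentiable f x.
Proof.
move=> df; rewrite (_ : f = \sum_(k < m) (fun y => f y k 0 *: delta_mx k 0)).
  by apply: differentiable_sum => k; apply: differentiableZl.
apply/funext => y; rewrite fct_sumE; apply/colP => k; rewrite summxE (bigD1 k) //= big1.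
  by rewrite !mxE !eqxx mulr1 addr0.
by move=> l lk; rewrite !mxE eq_sym (negbTE lk) mulr0.
Qed.

Lemma differentiable_pt_coord i z : differentiable (fun z : pt => coord z i) z.
Proof. exact: differentiable_coord. Qed.

Lemma differentiable_wvec z : differentiable (fun z : pt => wvec z) z.
Proof.
apply: differentiable_colvec => k.
rewrite (_ : (fun _ => _) = fun z : pt => \sum_(j : cidx n | tag j == k) coord z j).
  by apply: diff_sum => j _; exact: differentiable_pt_coord.
by apply/funext => y; rewrite wvecE.
Qed.

Lemma differentiable_pair_prod (F : cidx n -> cidx n -> pt -> C) z :
  (forall i j, differentiable (F i j) z) ->
  differentiable (fun z => pair_prod K (fun i j => F i j z)) z.
Proof.
move=> dF; rewrite (_ : (fun _ => _) = fun z =>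
  \prod_i \prod_(j | cidx_lt i j) F i j z ^+ K (tag i) (tag j)).
  by apply: diff_prod => i _; apply: diff_prod => j _; apply: diff_exp.
by apply/funext => y; rewrite pair_prodE.
Qed.

Lemma differentiable_coordB i j z : differentiable (fun z : pt => coord z i - coord z j) z.
Proof. by apply: diff_sub; exact: differentiable_pt_coord. Qed.

Lemma vartheta_local_quotient (x0 : pt) i j : exists h : C -> C,
  (forall t, differentiable h t) /\
  forall z, vartheta tau (coord z i - coord z j) =
    h (coord z i - coord z j) * diag_eqn tau x0 z i j.
Proof.
rewrite /diag_eqn; case: asboolP => [lat|_].
  have [h dh hE] := vartheta_lattice_zero tau_gt0 lat.
  by exists h; split => // z; rewrite hE mulrC.
exists (vartheta tau); split => [t|z]; last by rewrite mulr1.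
exact: vartheta_holomorphic.
Qed.

(** The theta quotients are entire, so a single [h], the product of the quotients over all pairs,
    works on the whole universal cover and not only near x0. *)
Lemma D_local_quotient (x0 : pt) : exists h : pt -> C,
  (forall z, differentiable h z) /\
  forall z, D tau K z = h z * pair_prod K (diag_eqn tau x0 z).
Proof.
have /choice [h hP] : forall ij : cidx n * cidx n, exists h : C -> C,
    (forall t, differentiable h t) /\
    forall z, vartheta tau (coord z ij.1 - coord z ij.2) =
      h (coord z ij.1 - coord z ij.2) * diag_eqn tau x0 z ij.1 ij.2.
  by move=> [i j]; exact: vartheta_local_quotient.
exists (fun z => pair_prod K (fun i j => h (i, j) (coord z i - coord z j))); split => z.
  apply: differentiable_pair_prod => i j; apply: (@diff_compC _ _ (h (i, j))).
    by case: (hP (i, j)).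
  exact: differentiable_coordB.
rewrite /D -pair_prodM; congr (pair_prod K _); apply/funext => i; apply/funext => j.
by have [_ ->] := hP (i, j).
Qed.

Lemma differentiable_D z : differentiable (fun z : pt => D tau K z) z.
Proof.
apply: differentiable_pair_prod => i j; apply: (@diff_compC _ _ (vartheta tau)).
  exact: vartheta_holomorphic.
exact: differentiable_coordB.
Qed.

Lemma natmx_wvec k z : (natmx R K *m wvec z) k 0 = \sum_j (K k (tag j))%:R * coord z j.
Proof.
rewrite mxE big_cidx; apply: eq_bigr => l _.
by rewrite !mxE /= mulr_sumr.
Qed.

Lemma intmx_delta (i : 'I_g.+1) : intmx R (delta_mx i 0 : 'cV[int]_g.+1) = delta_mx i 0.
Proof. by apply/matrixP => k l; rewrite !mxE; case: (_ && _). Qed.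

Lemma dot_delta m (i : 'I_m) (v : 'cV[C]_m) : dot (delta_mx i 0) v = v i 0.
Proof. by rewrite /dot trmx_delta -rowE mxE. Qed.

(** Put k = [tag i]. Over all j, including i, the product would be phi(z_i)^d exp(2 pi i (K w)_k),
    because the exponents sum to d. The absent factor j = i is phi(0)^K_kk = exp(- pi i tau K_kk).
    The multiplier U supplies exactly this factor, cancels exp(2 pi i (K w)_k) and leaves exp(- 2 pi
    i xi_k). *)
Lemma factor_of_automorphy xi i z :
  U tau K (intmx R (delta_mx (tag i) 0)) (wvec z) xi *
  \prod_(j | j != i) phi tau (coord z i - coord z j) ^+ K (tag i) (tag j) =
  expC (- (2 * pii * xi (tag i) 0)) * phi tau (coord z i) ^+ d.
Proof.
have phi_prod (j : cidx n) : phi tau (coord z i - coord z j) ^+ K (tag i) (tag j) =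
    expC ((- (pii * tau) - 2 * pii * (coord z i - coord z j)) * (K (tag i) (tag j))%:R).
  by rewrite mulr_natr expCMn /phi mulrA.
under eq_bigr do rewrite phi_prod.
rewrite -expC_sum /U -expCD.
have -> : phi tau (coord z i) ^+ d = expC ((- (pii * tau) - 2 * pii * coord z i) * d%:R).
  by rewrite mulr_natr expCMn /phi mulrA.
rewrite -expCD; congr expC.
have Kd : d%:R = \sum_(j : cidx n) (K (tag i) (tag j))%:R :> C.
  by rewrite -(sum_K i) natr_sum.
have Kw := natmx_wvec (tag i) z; rewrite mxE in Kw.
have OE : \sum_j Omega tau K (tag i) j * (delta_mx (tag i) 0 : 'cV[C]_g.+1) j 0
    = tau * (K (tag i) (tag i))%:R.
  rewrite (bigD1 (tag i)) //= big1 => [|j ji]; rewrite !mxE ?eqxx ?(negbTE ji) ?mulr0 //.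
  by rewrite mulr1 addr0.
rewrite intmx_delta dot_delta !mxE Kw OE.
pose f j : C := (- (pii * tau) - 2 * pii * (coord z i - coord z j)) * (K (tag i) (tag j))%:R.
have sum_f : \sum_j f j = (- (pii * tau) - 2 * pii * coord z i) * d%:R
    + 2 * pii * (\sum_j (K (tag i) (tag j))%:R * coord z j).
  by rewrite Kd !mulr_sumr -big_split; apply: eq_bigr => j _; rewrite /f /=; ring.
have -> : \sum_(j | j != i)
    (- (pii * tau) - 2 * pii * (coord z i - coord z j)) * (K (tag i) (tag j))%:R
  = \sum_j f j - f i by rewrite [\sum_j f j](bigD1 i) //= [RHS]addrC addKr.
rewrite sum_f /f.
ring.
Qed.
End Sections.

(** * Magnetic translations *)

Local Open Scope quotient_scope.

Section IntegerVectors.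
Variables (R : realType) (g : nat).
Local Notation C := (cplx R).
Implicit Types (x y : 'cV[rat]_g.+1) (c : QmodZ g).

Lemma int_vecP x : reflect (exists l : 'cV[int]_g.+1, x = map_mx intr l) (x \in @int_vec g).
Proof.
apply: (iffP forallP) => [xi|[l ->] i]; last by rewrite mxE intr_int.
have /choice [l lE] : forall i, exists k : int, x i 0 = k%:~R.
  by move=> i; apply/intrP.
by exists (\col_i l i); apply/colP => i; rewrite !mxE.
Qed.

Lemma ratmxD m (x y : 'cV[rat]_m) : ratmx R (x + y) = ratmx R x + ratmx R y.
Proof. exact: (map_mxD (@ratr C)). Qed.

Lemma ratmx_int m (l : 'cV[int]_m) : ratmx R (map_mx intr l) = intmx R l.
Proof. by apply/colP => i; rewrite !mxE ratr_int. Qed.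

Lemma ratmx_rc m (x : 'cV[rat]_m) : ratmx R x = map_mx (@rc R) (map_mx ratr x).
Proof. by apply/colP => i; rewrite !mxE fmorph_rat. Qed.

Lemma vclassD x y : vclass (x + y) = vclass x + vclass y.
Proof. exact: (raddfD (\pi_(Quotient.quot (@int_vec g)))). Qed.

Lemma vreprK c : vclass (vrepr c) = c.
Proof. exact: reprK. Qed.

Lemma vclass_eq x y : vclass x = vclass y ->
  exists l : 'cV[int]_g.+1, x = y + map_mx intr l.
Proof.
move=> /eqP; rewrite -Quotient.idealrBE => /int_vecP [l xy].
by exists l; rewrite -xy addrC subrK.
Qed.

Lemma vrepr_vclass x : exists l : 'cV[int]_g.+1, vrepr (vclass x) = x + map_mx intr l.
Proof. by apply: vclass_eq; rewrite vreprK. Qed.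
End IntegerVectors.

(** * The operators on both sides and the intertwining relations *)

Section Main.
Variables (R : realType) (tau : cplx R) (g : nat) (K : 'M[nat]_g.+1).
Variables (n : 'cV[nat]_g.+1) (d : nat) (xi : 'cV[cplx R]_g.+1).
Local Notation C := (cplx R).
Local Notation pt := 'cV[C]_#|cidx n|.
Local Notation pii := (piC R * iC R).
Hypotheses (tau_gt0 : 0 < complex.Im tau) (K_sym : K^T = K) (K_pos : posdef R K).
Hypothesis K_diag : (forall i, ~~ odd (K i i)) \/ (forall i, odd (K i i)).
Hypotheses (d_gt0 : (0 < d)%N) (Kn : K *m n = const_mx d).
Implicit Types (z : 'cV[C]_g.+1) (l : 'cV[int]_g.+1) (H : 'cV[C]_g.+1 -> C).

Let u : 'cV[C]_g.+1 := ratmx R (wen_u K).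
Let one_vec : 'cV[int]_g.+1 := const_mx 1.

Let d_neq0 : (d%:R : C) != 0.
Proof. by rewrite pnatr_eq0 -lt0n. Qed.

(** Definiteness is assumed over the reals while u is defined over the rationals; invertibility
    descends along the field embedding [ratr]. *)
Lemma ratK_unit : ratK K \in unitmx.
Proof.
rewrite -(map_unitmx (@ratr R)).
have -> : map_mx ratr (ratK K) = map_mx (fun k : nat => k%:R) K :> 'M[R]_g.+1.
  by apply/matrixP => i j; rewrite !mxE ratr_nat.
by apply: posdef_unitmx; exact: K_pos.
Qed.

Lemma natmx_rat : natmx R K = map_mx ratr (ratK K).
Proof. by apply/matrixP => i j; rewrite !mxE ratr_nat. Qed.

Lemma K_u : natmx R K *m u = intmx R one_vec.
Proof.
rewrite natmx_rat /u /ratmx -map_mxM mulKVmx ?ratK_unit //.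
by apply/colP => i; rewrite !mxE rmorph1.
Qed.

Lemma u_n : u = d%:R^-1 *: natmx R n.
Proof.
have dn0 : (d%:R : rat) != 0 by rewrite pnatr_eq0 -lt0n.
have -> : natmx R n = d%:R *: u.
  rewrite (_ : d%:R *: u = ratmx R (d%:R *: wen_u K)); last first.
    by apply/colP => i; rewrite !mxE rmorphM /= ratr_nat.
  have -> : d%:R *: wen_u K = map_mx (fun k : nat => k%:R) n.
    apply: (can_inj (mulKmx ratK_unit)).
    rewrite -scalemxAr mulKVmx ?ratK_unit //; apply/colP => i.
    have /matrixP /(_ i ord0) := Kn; rewrite !mxE mulr1 => <-.
    by rewrite natr_sum; apply: eq_bigr => j _; rewrite !mxE natrM.
  by apply/colP => i; rewrite !mxE ratr_nat.
by rewrite scalerA mulVf ?scale1r // pnatr_eq0 -lt0n.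
Qed.

Lemma Omega_u : Omega tau K *m u = tau *: intmx R one_vec.
Proof. by rewrite /Omega -scalemxAl K_u. Qed.

Lemma differentiable_shift m (s z : 'cV[C]_m) : differentiable (fun y => y + s) z.
Proof.
apply: differentiable_colvec => k.
under eq_fun do rewrite mxE.
by apply: diff_add; [exact: differentiable_coord | exact: diff_const].
Qed.

Lemma holomorphic_shift m (H : 'cV[C]_m -> C) (s : 'cV[C]_m) : holomorphic H ->
  holomorphic (fun z : 'cV[C]_m => H (z + s)).
Proof.
by move=> hH z; exact: (differentiable_comp (differentiable_shift s z) (hH (z + s))).
Qed.

Lemma differentiable_dot (a z : 'cV[C]_g.+1) : differentiable (dot a) z.
Proof.
rewrite (_ : dot a = fun y => \sum_i a i 0 * y i 0).
  apply: diff_sum => i _; apply: diff_mul; first exact: diff_const.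
  exact: differentiable_coord.
by apply/funext => y; rewrite dotE.
Qed.

Lemma UE (b z : 'cV[C]_g.+1) : U tau K b z xi =
  expC (- (pii * (2 * dot b xi + 2 * dot (natmx R K *m b) z + dot b (Omega tau K *m b)))).
Proof.
rewrite /U; congr (expC (- (_ * _))).
by rewrite !dotDr !dotZr (dot_sym b z (natmx_sym R K_sym)) (dotC z).
Qed.

Lemma U_Omega (b z : 'cV[C]_g.+1) : U tau K b z xi =
  expC (- (pii * dot b (Omega tau K *m b + 2 *: (natmx R K *m z + xi)))).
Proof.
rewrite /U; congr (expC (- (_ * dot _ _))).
by rewrite scalerDr addrC [2 *: _ + 2 *: _]addrC.
Qed.

Lemma holomorphic_U (b : 'cV[C]_g.+1) : holomorphic (fun z => U tau K b z xi).
Proof.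
move=> z; under eq_fun do rewrite UE.
apply: (@diff_compC _ _ (@expC R)); first exact: differentiable_expC.
apply: differentiableN; apply: diff_mul; first exact: diff_const.
apply: diff_add; last exact: diff_const.
apply: diff_add; first exact: diff_const.
by apply: diff_mul; [exact: diff_const | exact: differentiable_dot].
Qed.

Lemma U_shift (b z s : 'cV[C]_g.+1) : U tau K b (z + s) xi =
  U tau K b z xi * expC (- (2 * pii * dot (natmx R K *m b) s)).
Proof. by rewrite !UE -expCD; congr expC; rewrite dotDr; ring. Qed.

Lemma expC_2pi_dot_int (k l : 'cV[int]_g.+1) :
  expC (- (2 * pii * dot (intmx R k) (intmx R l))) = 1.
Proof. by have [m ->] := dot_int R k l; rewrite expCN mulrA expC_2pi_int invr1. Qed.

(** Translation by u multiplies U_l by exp(- 2 pi i l^t K u), which is 1 because K u = e is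
    integral. *)
Lemma S_op_W H : W_cm tau K xi H -> W_cm tau K xi (S_op u H).
Proof.
move=> [hH HP]; split => [|l z]; first exact: holomorphic_shift.
have [H1 H2] := HP l (z + u).
split; rewrite /S_op addrAC; first exact: H1.
rewrite H2 U_shift; congr (_ * _).
by rewrite dotC (dot_sym _ _ (natmx_sym R K_sym)) K_u expC_2pi_dot_int mulr1.
Qed.

(** Under z -> z + l the prefactor changes by exp(- 2 pi i e^t l) = 1. Under z -> z + tau l, both
    U_u and the multiplier U_l taken at z + tau u pick up exp(- 2 pi i tau u^t K l), once inverted
    and once not, and the two cancel. *)
Lemma R_op_W H : W_cm tau K xi H -> W_cm tau K xi (R_op tau K xi u H).
Proof.
move=> [hH HP]; split => [z|l z].
  apply: diff_mul; last exact: holomorphic_shift.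
  by apply: differentiableV; [exact: holomorphic_U | exact: expC_neq0].
have [H1 H2] := HP l (z + tau *: u).
split; rewrite /R_op addrAC.
  by rewrite H1 U_shift K_u expC_2pi_dot_int mulr1.
rewrite H2 !U_shift !dotZr (dotC (natmx R K *m intmx R l)) (dot_sym u _ (natmx_sym R K_sym)).
rewrite (dotC (intmx R l)).
have := expC_neq0 (- (2 * pii * (tau * dot (natmx R K *m u) (intmx R l)))).
have : U tau K u z xi != 0 by exact: expC_neq0.
move: (expC _) (U tau K u z xi) (U tau K (intmx R l) z xi) (H _) => e a b h a0 e0.
by field; rewrite a0 e0.
Qed.

Let W := W_cm tau K xi.
Let V := V_X tau K n d xi.
Let io := iota_WV tau K n.

(** Common form of T_1 and T_2. A simultaneous shift preserves all differences of variables, so the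
    local equations at x0 and at x0 + c correspond, and the local quotient of f at x0 + c is
    transported back to x0. *)
Lemma V_shift (P : pt -> C) (c : C) (f : pt -> C) : V f -> holomorphic P ->
  W_X tau K n d xi (fun z : pt => P z * f (z + const_mx c)) ->
  V (fun z : pt => P z * f (z + const_mx c)).
Proof.
move=> [_ Vf] hP Wf; split => // x0; have [h hE] := Vf (x0 + const_mx c).
exists (fun z : pt => P z * h (z + const_mx c)).
have cs : (fun z : pt => z + const_mx c) @ x0 --> x0 + const_mx c.
  exact: (differentiable_continuous (differentiable_shift (const_mx c) x0)).
have F0 : Filter (nbhs (x0 : pt)) by exact _.
apply: (@filterS _ (nbhs (x0 : pt)) F0 _ _ _ (cs _ hE)) => z /= [dh hz].
split.
  apply: diff_mul; first exact: hP.
  exact: (differentiable_comp (differentiable_shift (const_mx c) z) dh).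
rewrite hz mulrA; congr (_ * pair_prod K _); apply/funext => i; apply/funext => j.
by rewrite /diag_eqn !coord_const !(opprD _ c) !(addrACA _ c) subrr !addr0.
Qed.

Lemma iota_V H : W H -> V (io H).
Proof.
move=> [hH HP]; have hHw : holomorphic (fun z : pt => H (wvec z)).
  by move=> z; exact: (differentiable_comp (differentiable_wvec z) (hH (wvec z))).
split; last first.
  move=> x0; have [h [dh hE]] := D_local_quotient K tau_gt0 x0.
  exists (fun z : pt => H (wvec z) * h z); near=> z; split.
    by apply: diff_mul; [exact: hHw | exact: dh].
  by rewrite /io /iota_WV hE mulrA.
split => [z|i z].
  by apply: diff_mul; [exact: hHw | exact: differentiable_D].
rewrite /io /iota_WV !wvec_shift1 scale1r.
have [-> _] := HP (delta_mx (tag i) 0) (wvec z).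
have [_ ->] := HP (delta_mx (tag i) 0) (wvec z).
split.
  rewrite (@D_shift R tau g K n d tau_gt0 K_sym Kn K_diag z i 1 (fun=> 1)); last first.
    by move=> x; rewrite vartheta_shift1 // mulN1r.
  by rewrite big1 ?mulr1 => [|j _]; [rewrite mulrCA | rewrite expr1n].
rewrite (D_shift tau_gt0 K_sym Kn K_diag z i (vartheta_shift_tau tau_gt0)).
rewrite -(mulrA 2 (piC R) (iC R)).
move: (factor_of_automorphy tau Kn xi i z).
move: (U _ _ _ _ _) (\prod_(_ | _) _) (expC _) (phi _ _ ^+ _) => a b e p E.
move: (H _) (D _ _ _) (bundle_sign _ _ _) => h q s.
by rewrite -(mulrA s e p) -E; ring.
Unshelve. all: by end_near. Qed.

Lemma phi_shift (s : C) x : phi tau (x + s) = phi tau x * expC (- (2 * pii * s)).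
Proof. by rewrite /phi -expCD; congr expC; ring. Qed.

(** The reason for the steps 1/d and tau/d: the d-th power turns them into full periods. For s = 1
    the extra factor is 1; for s = tau it is compensated by the change of [T2_factor] under z_i ->
    z_i + tau. *)
Lemma phi_shift_exp (s : C) x :
  phi tau (x + s / d%:R) ^+ d = phi tau x ^+ d * (expC (2 * pii * s))^-1.
Proof.
rewrite phi_shift exprMn -expCN; congr (_ * _); rewrite -expCMn; congr expC.
rewrite -(mulr_natr (- _)); by field.
Qed.

Lemma T1_V f : V f -> V (T1 n d f).
Proof.
move=> Vf; have [[hf fP] _] := Vf.
have -> : T1 n d f = fun z : pt => 1 * f (z + const_mx d%:R^-1).
  by apply/funext => z; rewrite mul1r.
apply: V_shift; [exact: Vf | by move=> z; exact: diff_const |].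
split => [z|i z].
  by apply: diff_mul; [exact: diff_const | exact: holomorphic_shift].
have [f1 f2] := fP i (z + const_mx d%:R^-1).
split; rewrite !mul1r [z + _ + _]addrAC; first exact: f1.
have E : phi tau (coord (z + const_mx d%:R^-1) i) ^+ d = phi tau (coord z i) ^+ d.
  by rewrite coord_const -[d%:R^-1]mul1r phi_shift_exp mulr1 mulrA expC_2pi invr1 mulr1.
by rewrite E in f2.
Qed.

Definition T2_factor (z : pt) : C :=
  \prod_(i : cidx n)
    (expC ((2 * piC R * iC R * xi (tag i) 0 + piC R * iC R * tau) / d%:R)
     * expC (2 * piC R * iC R * coord z i)).

Lemma T2_factor_shift (z : pt) i t :
  T2_factor (z + shift1 i t) = T2_factor z * expC (2 * pii * t).
Proof.
rewrite /T2_factor (bigD1 i) //= [in RHS](bigD1 i) //= coord_shift1 eqxx.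
rewrite [X in _ * X = _](eq_bigr (fun j =>
  expC ((2 * piC R * iC R * xi (tag j) 0 + piC R * iC R * tau) / d%:R)
     * expC (2 * piC R * iC R * coord z j))); last first.
  by move=> j ji; rewrite coord_shift1 (negbTE ji) addr0.
rewrite mulrDr [expC (_ + _)]expCD -(mulrA 2 (piC R) (iC R)).
move: (expC _) (expC _) (expC _) (\prod_(_ | _) _) => a b e p; ring.
Qed.

Lemma holomorphic_T2_factor : holomorphic T2_factor.
Proof.
move=> z; apply: diff_prod => i _; apply: diff_mul; first exact: diff_const.
apply: (@diff_compC _ _ (@expC R)); first exact: differentiable_expC.
by apply: diff_mul; [exact: diff_const | exact: differentiable_pt_coord].
Qed.

Lemma T2_V f : V f -> V (T2 tau n d xi f).
Proof.
move=> Vf; have [[hf fP] _] := Vf.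
apply: (@V_shift T2_factor); [exact: Vf | exact: holomorphic_T2_factor |].
split => [z|i z].
  by apply: diff_mul; [exact: holomorphic_T2_factor | exact: holomorphic_shift].
have [f1 f2] := fP i (z + const_mx (tau / d%:R)).
split; rewrite [z + _ + _]addrAC T2_factor_shift.
  by rewrite f1 mulr1 (mulrA 2 (piC R)) expC_2pi mulr1 mulrCA.
rewrite f2.
rewrite coord_const phi_shift_exp -(mulrA 2 (piC R) (iC R)).
have := expC_neq0 (2 * pii * tau); move: (expC _) => e e0.
move: (T2_factor z) (expC _) (phi _ _ ^+ _) (f _) (bundle_sign _ _ _) => a b p h s.
by field.
Qed.

(** Since u = n / d, pairing with u is a sum over all variables divided by d. This turns the
    exponents u^t xi and u^t e of U_u into the product over variables in T_2. *)
Lemma dot_u (v : 'cV[C]_g.+1) : dot u v = d%:R^-1 * \sum_(j : cidx n) v (tag j) 0.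
Proof.
rewrite u_n dotZl dotE (sum_cidx n (fun k => v k 0)); congr (_ * _).
by apply: eq_bigr => k _; rewrite !mxE.
Qed.

Lemma T2_factorE (z : pt) : T2_factor z = (U tau K u (wvec z) xi)^-1.
Proof.
rewrite UE K_u -expCN opprK Omega_u !dot_u.
have -> : dot (intmx R one_vec) (wvec z) = \sum_(j : cidx n) coord z j.
  rewrite dotE big_cidx; apply: eq_bigr => k _.
  by rewrite !mxE mul1r.
have -> : \sum_(j : cidx n) (tau *: intmx R one_vec) (tag j) 0 = \sum_(j : cidx n) tau.
  by apply: eq_bigr => j _; rewrite !mxE mulr1.
rewrite /T2_factor; under eq_bigr do rewrite -expCD.
rewrite -expC_sum; congr expC; rewrite !mulrDr !mulr_sumr -!big_split /=.
by apply: eq_bigr => j _; field; rewrite d_neq0.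
Qed.

Lemma T1_iota H : T1 n d (io H) = io (S_op u H).
Proof.
apply/funext => z; rewrite /T1 /io /iota_WV /S_op D_const; congr (H _ * _).
by rewrite wvec_const u_n.
Qed.

Lemma T2_iota H : T2 tau n d xi (io H) = io (R_op tau K xi u H).
Proof.
apply/funext => z; rewrite /T2 /io /iota_WV /R_op D_const -/(T2_factor z) T2_factorE.
by rewrite mulrA wvec_const u_n scalerA.
Qed.

(** * The functions Phi_c *)

Let Hc (c : 'cV[rat]_g.+1) : 'cV[C]_g.+1 -> C :=
  fun z => Theta (ratmx R c) 0 (natmx R K *m z + xi) (Omega tau K).

Lemma K_char_int (c : 'cV[rat]_g.+1) (l : 'cV[int]_g.+1) :
  ratK K *m c = map_mx intr l -> natmx R K *m ratmx R c = intmx R l.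
Proof.
by move=> Kc; rewrite natmx_rat /ratmx -map_mxM Kc; exact: ratmx_int.
Qed.

(** Invariance under z -> z + l requires c^t K l to be an integer, which is where K c integral
    enters. The other quasi-period is Theta with characteristic c + l, and l is removed by
    reindexing. *)
Lemma Hc_W (c : 'cV[rat]_g.+1) (k : 'cV[int]_g.+1) :
  ratK K *m c = map_mx intr k -> W (Hc c).
Proof.
move=> /K_char_int Kc; rewrite /Hc ratmx_rc in Kc *; split => [z|l z].
  pose aff (y : 'cV[C]_g.+1) := natmx R K *m y + xi.
  have daff : differentiable aff z.
    apply: differentiable_colvec => i.
    rewrite (_ : (fun _ => _) = fun y : 'cV[C]_g.+1 => \sum_j natmx R K i j * y j 0 + xi i 0).
      apply: diff_add; last exact: diff_const.
      apply: diff_sum => j _; apply: diff_mul; first exact: diff_const.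
      exact: differentiable_coord.
    by apply/funext => y; rewrite !mxE.
  exact: (differentiable_comp daff (Theta_holomorphic tau_gt0 K_sym K_pos _ (aff z))).
split.
  have -> : natmx R K *m (z + intmx R l) + xi =
      natmx R K *m z + xi + intmx R (map_mx (fun k : nat => k%:Z) K *m l).
    rewrite mulmxDr addrAC; congr (_ + _ + _); rewrite /intmx map_mxM; congr (_ *m _).
    by apply/matrixP => i j; rewrite !mxE.
  rewrite (Theta_shift_int tau_gt0 K_sym K_pos).
  have -> : intmx R (map_mx (fun k : nat => k%:Z) K *m l) = natmx R K *m intmx R l.
    rewrite /intmx map_mxM; congr (_ *m _).
    by apply/matrixP => i j; rewrite !mxE.
  rewrite (dot_sym _ _ (natmx_sym R K_sym)) Kc.
  have [m ->] := dot_int R l k.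
  by rewrite expC_2pi_int mul1r.
have -> : natmx R K *m (z + tau *: intmx R l) + xi =
    natmx R K *m z + xi + Omega tau K *m intmx R l.
  by rewrite mulmxDr -scalemxAr scalemxAl addrAC.
rewrite intmx_rc (Theta_shift_Omega tau_gt0 K_sym K_pos) (Theta_char_int tau_gt0 K_sym K_pos).
by rewrite U_Omega.
Qed.

Lemma Hc_int (c : 'cV[rat]_g.+1) (l : 'cV[int]_g.+1) : Hc (c + map_mx intr l) = Hc c.
Proof.
apply/funext => z; rewrite /Hc !ratmx_rc.
have -> : map_mx ratr (c + map_mx intr l) = map_mx ratr c + map_mx intr l :> 'cV[R]_g.+1.
  by apply/colP => i; rewrite !mxE rmorphD /= ratr_int.
exact: (Theta_char_int tau_gt0 K_sym K_pos).
Qed.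

Lemma S_Hc (c : 'cV[rat]_g.+1) : S_op u (Hc c) =
  fun z => expC (2 * piC R * iC R * dot (ratmx R c) (intmx R one_vec)) * Hc c z.
Proof.
apply/funext => z; rewrite /S_op /Hc mulmxDr K_u addrAC ratmx_rc.
exact: (Theta_shift_int tau_gt0 K_sym K_pos).
Qed.

Lemma R_Hc (c : 'cV[rat]_g.+1) : R_op tau K xi u (Hc c) = Hc (c + wen_u K).
Proof.
apply/funext => z; rewrite /R_op /Hc.
have -> : natmx R K *m (z + tau *: u) + xi = natmx R K *m z + xi + Omega tau K *m u.
  by rewrite mulmxDr -scalemxAr scalemxAl addrAC.
rewrite ratmxD /u !ratmx_rc (Theta_shift_Omega tau_gt0 K_sym K_pos) map_mxD.
by rewrite U_Omega mulKf // expC_neq0.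
Qed.

(** K times a representative changes by K m with m integral, so integrality does not depend on the
    representative chosen by [vrepr]. *)
Lemma Pi_char c : Pi K c -> exists k : 'cV[int]_g.+1, ratK K *m vrepr c = map_mx intr k.
Proof.
move=> [l /int_vecP [k ->] <-].
have [m ->] := vrepr_vclass (invmx (ratK K) *m map_mx intr k).
exists (k + map_mx (fun k : nat => k%:Z) K *m m).
rewrite mulmxDr mulKVmx ?ratK_unit // map_mxD map_mxM; congr (_ + _ *m _).
by apply/matrixP => i j; rewrite !mxE.
Qed.

Lemma Pi_u : Pi K (vclass (wen_u K)).
Proof.
exists (const_mx 1) => //=; apply/int_vecP; exists one_vec.
by apply/colP => i; rewrite !mxE.
Qed.

Lemma PiD (c c' : QmodZ g) : Pi K c -> Pi K c' -> Pi K (c + c').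
Proof.
move=> [l lint <-] [l' lint' <-]; exists (l + l'); first exact: rpredD.
by rewrite mulmxDr vclassD.
Qed.

(** The chosen representative of the class of u is u + m with m integral. Here m contributes exp(2
    pi i m^t K c) = 1, and u contributes c^t K u = c^t e. *)
Lemma upsilon_u c (k : 'cV[int]_g.+1) : ratK K *m vrepr c = map_mx intr k ->
  upsilon R K (vclass (wen_u K)) c =
  expC (2 * piC R * iC R * dot (ratmx R (vrepr c)) (intmx R one_vec)).
Proof.
move=> /K_char_int Kc; rewrite /upsilon.
have [m ->] := vrepr_vclass (wen_u K).
rewrite ratmxD ratmx_int dotDl {2}Kc (dot_sym _ _ (natmx_sym R K_sym)) K_u.
have [p ->] := dot_int R m k.
by rewrite mulrDr expCD expC_2pi_int mulr1.
Qed.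

Lemma PhiE c : Phi tau K n xi c = io (Hc (vrepr c)).
Proof. by []. Qed.

Lemma T1_Phi c : Pi K c ->
  T1 n d (Phi tau K n xi c) =
  fun z : pt => upsilon R K (vclass (wen_u K)) c * Phi tau K n xi c z.
Proof.
move=> /Pi_char [k ck]; rewrite PhiE T1_iota S_Hc (upsilon_u ck).
by apply/funext => z; rewrite /io /iota_WV mulrA.
Qed.

Lemma T2_Phi c : T2 tau n d xi (Phi tau K n xi c) = Phi tau K n xi (c + vclass (wen_u K)).
Proof.
rewrite !PhiE T2_iota R_Hc.
(* The representative of the sum of the classes and the sum of the representatives differ by an
   integral vector, which [Hc] does not see. *)
have [l ->] : exists l : 'cV[int]_g.+1, vrepr (c + vclass (wen_u K)) =
    vrepr c + wen_u K + map_mx intr l.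
  by apply: vclass_eq; rewrite vclassD !vreprK.
by rewrite Hc_int.
Qed.
End Main.

Theorem lemma5p12 (R : realType) (tau : cplx R) (htau : 0 < complex.Im tau)
    (g : nat) (K : 'M[nat]_g.+1) (n : 'cV[nat]_g.+1) (d : nat)
    (hKn : wen_datum R K n d) (xi : 'cV[cplx R]_g.+1) :
  let u := ratmx R (wen_u K) in
  let W := W_cm tau K xi in
  let V := V_X tau K n d xi in
  let io := iota_WV tau K n in
  let S := S_op u in
  let Ru := R_op tau K xi u in
  let t1 := T1 n d in
  let t2 := T2 tau n d xi in
  let Ph := Phi tau K n xi in
  let uc := vclass (wen_u K) in
  [/\ set_fun W V io, set_fun W W S, set_fun W W Ru,
      set_fun V V t1 & set_fun V V t2] /\
  (forall H : 'cV[cplx R]_g.+1 -> cplx R, W H ->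
     t1 (io H) = io (S H) /\ t2 (io H) = io (Ru H)) /\
  Pi K uc /\
  (forall c, Pi K c ->
    [/\ Pi K (c + uc), V (Ph c),
        t1 (Ph c) = (fun z => upsilon R K uc c * Ph c z) &
        t2 (Ph c) = Ph (c + uc)]).
Proof.
have [[K_sym K_pos K_diag _] _ d_gt0 Kn] := hKn.
split; first split.
- by move=> H; exact: iota_V.
- by move=> H; exact: S_op_W.
- by move=> H; exact: R_op_W.
- by move=> f; exact: T1_V.
- by move=> f; exact: T2_V.
split; first by move=> H _; split; [exact: T1_iota | exact: T2_iota].
split=> [|c cP]; first exact: Pi_u.
split; first exact: (PiD cP (Pi_u K)).
- have [k ck] := Pi_char K_pos cP.
  exact: (iota_V htau K_sym K_diag Kn (Hc_W xi htau K_sym K_pos ck)).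
- exact: (T1_Phi xi htau K_sym K_pos d_gt0 Kn cP).
- exact: (T2_Phi xi htau K_sym K_pos d_gt0 Kn c).
Qed.
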